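(* Let $\mathfrak{C}$ be the C$^*$-algebra constructed in the context from $(\mathcal{H}_n)_{n \geq 1}$, $(A_n)_{n\geq 1}$, $(M_n)_{n\geq 1}$, $(\xi_n)_{n \geq 1}$. Then $\mathfrak{C}$ has a (norm) dense subalgebra $\mathfrak{N}$ such that every operator of $\mathfrak{N}$ is nilpotent.
   Context: Construction of $\mathfrak{C}$. Fix finite dimensional Hilbert spaces $\mathcal{H}_n$ ($n \geq 1$), positive operators $A_n \in \mathcal{B}(\mathcal{H}_n)$ of norm one, and nilpotent operators $M_n \in \mathcal{B}(\mathcal{H}_n)$ such that $\sum_{n \geq 1} \|A_n - M_n\| < \infty$ (such a choice exists), and unit vectors $\xi_n \in \mathcal{H}_n$ with $A_n \xi_n = \xi_n$ for all $n$. For $n < m$ let $\phi_{n,m} : \bigotimes_{k=1}^n \mathcal{H}_k \to \bigotimes_{k=1}^m \mathcal{H}_k$ be the isometry $\phi_{n,m}(\eta_1 \otimes \cdots \otimes \eta_n) = \eta_1 \otimes \cdots \otimes \eta_n \otimes \xi_{n+1} \otimes \cdots \otimes \xi_m$. Let $\mathcal{K} = \bigotimes_{k=1}^\infty \mathcal{H}_k$ be the Hilbert space completion of the direct limit of the spaces $\bigotimes_{k=1}^n \mathcal{H}_k$ along the maps $\phi_{n,m}$, with natural inclusions $\phi_n : \bigotimes_{k=1}^n \mathcal{H}_k \to \mathcal{K}$. Call a sequence $(S_n)_{n\geq 1}$ with $S_n \in \mathcal{B}(\mathcal{H}_n)$ admissible if $\prod_{n \geq 1} \max\{\|S_n\|,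 1\} < \infty$ and $\sum_{n\geq 1} \|S_n \xi_n - \xi_n\| < \infty$. For an admissible sequence there is a unique bounded operator $\bigotimes_{n=1}^\infty S_n \in \mathcal{B}(\mathcal{K})$ satisfying $(\bigotimes_{n=1}^\infty S_n)(\phi_n \zeta) = \lim_{m \to \infty} \phi_m\big( (\bigotimes_{i=1}^m S_i)\, \phi_{n,m}(\zeta) \big)$ for all $n$ and all $\zeta \in \bigotimes_{k=1}^n \mathcal{H}_k$. Let $\mathcal{E}_A$ be the set of all operators $\bigotimes_{n=1}^\infty S_n$ coming from admissible sequences for which there exists $k \in \mathbb{N}$ with $S_n = A_n$ for all $n \geq k$. Let $\mathfrak{C}$ be the C$^*$-subalgebra of $\mathcal{B}(\mathcal{K})$ generated by $\mathcal{E}_A$. A subalgebra here need not be closed nor self-adjoint. An operator $T$ is nilpotent if $T^k = 0$ for some $k \in \mathbb{N}$. *)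

(* Defs.v *)
From HB Require Import structures.
From mathcomp Require Import all_boot all_order all_algebra.
From mathcomp Require Import all_classical all_reals all_analysis.
From mathcomp Require Import complex.

Set Implicit Arguments.
Unset Strict Implicit.
Unset Printing Implicit Defensive.

Import Order.TTheory GRing.Theory Num.Theory.
Import numFieldNormedType.Exports.

Local Open Scope classical_set_scope.
Local Open Scope ring_scope.
Local Open Scope complex_scope.

(* Complex Hilbert spaces; inner products are linear in the first argument. *)
HB.mixin Record CompleteNormedModule_isHilbert (R : realType) (V : Type)
    of CompleteNormedModule R[i] V := {
  inner : {dot V for (@Num.conj R[i])} ;
  normr_inner : forall x : V, `|x| ^+ 2 = inner x x
}.

#[short(type="hilbertType")]
HB.structure Definition Hilbert (R : realType) :=
  { V of CompleteNormedModule_isHilbert R V & CompleteNormedModule R[i] V }.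

#[short(type="finHilbertType")]
HB.structure Definition FinHilbert (R : realType) :=
  { V of Hilbert R V & Vector R[i] V }.

Section Operators.
Context {R : realType}.
Implicit Types (U V : hilbertType R).

(* MathComp-Analysis norms on R[i]-modules take their values in R[i]; this is
   the same norm as an element of R. *)
Definition hnorm V (x : V) : R := complex.Re `|x|.

Definition bounded_op U V (f : U -> V) : Prop :=
  linear f /\ exists c : R, forall x, hnorm (f x) <= c * hnorm x.

(* Only meaningful on bounded operators: sup is 0 on unbounded sets. *)
Definition opnorm U V (f : U -> V) : R :=
  sup [set hnorm (f x) | x in [set x | hnorm x <= 1]].

Definition linear_isometry U V (f : U -> V) : Prop :=
  linear f /\ forall x, hnorm (f x) = hnorm x.

Definition positive_op V (f : V -> V) : Prop :=
  bounded_op f /\ forall x, 0 <= inner (f x) x.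

Definition nilpotent_op V (f : V -> V) : Prop :=
  exists k : nat, forall x, iter k f x = 0.

Definition adjoint_op V (f g : V -> V) : Prop :=
  forall x y, inner (f x) y = inner x (g y).

(* Not assumed to be unital, closed or self-adjoint. *)
Definition is_subalgebra V (B : set (V -> V)) : Prop :=
  [/\ forall f, B f -> bounded_op f,
      B 0,
      forall f g, B f -> B g -> B (f + g),
      forall (a : R[i]) f, B f -> B (a *: f) &
      forall f g, B f -> B g -> B (f \o g)].

(* The library's closure on V -> V is that of pointwise convergence, hence
   this explicit operator-norm closure, taken inside the bounded operators. *)
Definition opnorm_closure V (B : set (V -> V)) : set (V -> V) :=
  [set f | bounded_op f /\
     forall e : R, 0 < e -> exists2 g, B g & opnorm (f - g) < e].

Definition is_cstar_subalgebra V (B : set (V -> V)) : Prop :=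
  [/\ is_subalgebra B,
      opnorm_closure B `<=` B &
      forall f g, B f -> bounded_op g -> adjoint_op f g -> B g].

Definition generated_cstar V (E : set (V -> V)) : set (V -> V) :=
  smallest (@is_cstar_subalgebra V) E.

End Operators.

(* Realizations of the tensor product of finitely many finite-dimensional
   Hilbert spaces; any two are related by a unique unitary matching the
   elementary tensors. *)
Record tensor_product (R : realType) (I : finType)
    (H : I -> finHilbertType R) := TensorProduct {
  tp_space :> hilbertType R ;
  tens : (forall i, H i) -> tp_space ;
  tens_multilinear : forall (x : forall i, H i) (i : I),
    linear (fun u : H i => tens (@dfwith I H x i u)) ;
  inner_tens : forall x y : forall i, H i,
    inner (tens x) (tens y) = \prod_i inner (x i) (y i) ;
  tens_span : forall z : tp_space,
    exists (r : nat) (c : 'I_r -> R[i]) (x : 'I_r -> forall i, H i),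
      z = \sum_(j < r) c j *: tens (x j)
}.

Definition is_tensor_op (R : realType) (I : finType)
    (H : I -> finHilbertType R) (T : tensor_product H)
    (S : forall i, H i -> H i) (P : T -> T) : Prop :=
  linear P /\
  forall x : forall i, H i, P (tens T x) = tens T (fun i => S i (x i)).

(* Sequences indexed from 1 in the mathematics are indexed from 0 here: H n is
   the (n+1)-st space, and T n the tensor product of the first n+1 spaces. *)
Definition is_tensor_embedding (R : realType) (H : nat -> finHilbertType R)
    (xi : forall n, H n)
    (T : forall n, tensor_product (fun k : 'I_n.+1 => H k))
    (n m : nat) (f : T n -> T m) : Prop :=
  linear_isometry f /\
  forall eta : forall k, H k,
    f (tens (T n) (fun k => eta k)) =
    tens (T m) (fun k => if (k <= n)%N then eta k else xi k).

(* Realizations of the Hilbert space completion of the direct limit of the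
   T n along the phi n m with n < m. *)
Record limit_completion (R : realType) (T : nat -> hilbertType R)
    (phi : forall n m, T n -> T m) := LimitCompletion {
  lc_space :> hilbertType R ;
  lc_incl : forall n, T n -> lc_space ;
  lc_incl_isometry : forall n, linear_isometry (@lc_incl n) ;
  lc_incl_compat : forall n m (z : T n), (n < m)%N ->
    lc_incl (phi n m z) = lc_incl z ;
  lc_incl_dense : dense (\bigcup_n range (@lc_incl n))
}.

Section InfiniteTensor.
Context {R : realType} {H : nat -> finHilbertType R}.
Variable xi : forall n, H n.
Context {T : forall n, tensor_product (fun k : 'I_n.+1 => H k)}.
Context {phi : forall n m, T n -> T m}.
Variable K : limit_completion phi.

Definition admissible (S : forall n, H n -> H n) : Prop :=
  [/\ forall n, bounded_op (S n),
      cvgn (fun n => \prod_(i < n) Num.max (opnorm (S i)) 1) &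
      cvgn (series (fun n => hnorm (S n (xi n) - xi n)))].

(* X is the infinite tensor product of the S n; P m is the tensor product of
   S 0, ..., S m. *)
Definition is_infinite_tensor_op (S : forall n, H n -> H n)
    (X : K -> K) : Prop :=
  bounded_op X /\
  exists P : forall m, T m -> T m,
    (forall m, is_tensor_op (fun k : 'I_m.+1 => S k) (P m)) /\
    forall n (z : T n),
      (fun m => lc_incl K (P m (@phi n m z))) @ \oo --> X (lc_incl K z).

Definition E_set (A : forall n, H n -> H n) : set (K -> K) :=
  [set X | exists S : forall n, H n -> H n,
     [/\ admissible S,
         exists k : nat, forall n, (k <= n)%N -> S n = A n &
         is_infinite_tensor_op S X]].

Definition C_alg (A : forall n, H n -> H n) : set (K -> K) :=
  generated_cstar (E_set A).

End InfiniteTensor.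

Arguments C_alg {R H} xi {T phi} K A _.

(* Main.v *)
Require Import Defs.
From HB Require Import structures.
From mathcomp Require Import all_boot all_order all_algebra.
From mathcomp Require Import all_classical all_reals all_analysis.
From mathcomp Require Import complex ring lra.
Import Order.TTheory GRing.Theory Num.Theory.
Import numFieldNormedType.Exports.
Local Open Scope classical_set_scope.
Local Open Scope ring_scope.
Local Open Scope complex_scope.
Set Implicit Arguments.
Unset Strict Implicit.
Unset Printing Implicit Defensive.

(** Each X in the generating set has, from some coordinate on, the tail A n.
    Replacing A n by the nilpotent M n at all coordinates n >= m produces an
    operator Y within const * sum_{n >= m} |A n - M n| of X, and Y lies in the
    C*-algebra because it is in turn the norm limit of the operators obtained
    by putting A n back at the coordinates n >= p, as p grows
    ([nil_tail_limit]).

    What makes these Y nilpotent, and all their sums and products with them, is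
    the following.  Let L n be the operator acting as M n on coordinate n and
    as the identity elsewhere; it is nilpotent.  The operator Y commutes with
    L n and is a multiple L n Z of it whenever n >= m: take for Z the operator
    Y with the factor M n deleted.  For a fixed L, the operators X that commute
    with L and are of the form L Z are closed under linear combinations and
    products, and X L^p = L^p X = L^(p+1) Z shows inductively that the range of
    X^p lies in that of L^p, so that X is nilpotent when L is
    ([commuting_multiple_nilpotent]).  The algebra of the theorem consists of
    the elements of the C*-algebra that are commuting multiples of L n for all
    large n ([nil_alg]).  Any two of its members are commuting multiples of
    a common L n, so their sums and products are again in it.

    Density: the closure of an algebra is an algebra, and the elements of a
    closed algebra whose adjoint also lies in it form a C*-algebra
    ([cstar_selfadjoint_part]).  Applied to the closure of [nil_alg], this
    C*-algebra contains the generators, because the adjoint of a generator with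
    tail A n is again one: A n is positive, hence self-adjoint.

    Everything quantitative rests on one inequality: if |S i| <= C i for all i,
    then the tensor product of the S i has norm at most the product of the C i.
    It is proved directly on sums of elementary tensors ([tens_comb_bound]):
    the difference of the two Gram kernels is positive semidefinite by the Schur
    product theorem, itself a consequence of Parseval's identity in each
    factor.  The inequality gives both the existence of product operators, by
    extending a bounded linear relation with dense domain ([op_extension]), and
    the norm estimates on the infinite tensor product. *)

(** * Hilbert space preliminaries *)

Section HilbertBasics.
Context {R : realType}.
Implicit Types (V : hilbertType R).

Lemma hnormE V (x : V) : `|x| = (hnorm x)%:C.
Proof. by rewrite /hnorm RRe_real // ger0_real. Qed.

Lemma hnorm_ge0 V (x : V) : 0 <= hnorm x.
Proof. by rewrite -ler0c -hnormE. Qed.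

Lemma hnorm0 V : hnorm (0 : V) = 0.
Proof. by rewrite /hnorm normr0. Qed.

Lemma hnorm_eq0 V (x : V) : hnorm x = 0 -> x = 0.
Proof. by move=> h; apply/normr0_eq0; rewrite hnormE h. Qed.

Lemma hnormD V (x y : V) : hnorm (x + y) <= hnorm x + hnorm y.
Proof. by rewrite -lecR rmorphD /= -!hnormE ler_normD. Qed.

Lemma hnormN V (x : V) : hnorm (- x) = hnorm x.
Proof. by rewrite /hnorm normrN. Qed.

Lemma hnormBC V (x y : V) : hnorm (x - y) = hnorm (y - x).
Proof. by rewrite -hnormN opprB. Qed.

Lemma hnorm_dist V (x y z : V) : hnorm (x - y) <= hnorm (x - z) + hnorm (z - y).
Proof. by rewrite -{1}[x](subrK z) -addrA hnormD. Qed.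

Lemma hnormZ V (a : R[i]) (x : V) : hnorm (a *: x) = Normc.normc a * hnorm x.
Proof. by apply: complexI; rewrite -hnormE normrZ rmorphM /= -hnormE. Qed.

Lemma hnormZ_ge0 V (a : R) (x : V) : 0 <= a -> hnorm (a%:C *: x) = a * hnorm x.
Proof.
move=> a0; apply: complexI; rewrite -hnormE normrZ rmorphM /= -hnormE.
by rewrite ger0_norm // ler0c.
Qed.

Lemma innerPl V (a : R[i]) (x y z : V) :
  inner (a *: x + y) z = a * inner x z + inner y z.
Proof. by rewrite linearPl. Qed.

Lemma innerPr V (a : R[i]) (x y z : V) :
  inner z (a *: x + y) = a^*%R * inner z x + inner z y.
Proof. by rewrite linearPr. Qed.

Lemma innerC V (x y : V) : inner x y = (inner y x)^*%R.
Proof. by rewrite {1}hermC expr0 mul1r. Qed.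

Lemma innerZl V (a : R[i]) (x z : V) : inner (a *: x) z = a * inner x z.
Proof. by rewrite linearZl_LR. Qed.

Lemma innerZr V (a : R[i]) (x z : V) : inner x (a *: z) = a^*%R * inner x z.
Proof. by rewrite linearZr_LR. Qed.

Lemma inner_suml V I (r : seq I) (P : pred I) (F : I -> V) z :
  inner (\sum_(i <- r | P i) F i) z = \sum_(i <- r | P i) inner (F i) z.
Proof. by rewrite linear_sumlz. Qed.

Lemma inner_sumr V I (r : seq I) (P : pred I) (F : I -> V) z :
  inner z (\sum_(i <- r | P i) F i) = \sum_(i <- r | P i) inner z (F i).
Proof. by rewrite linear_sumr. Qed.

Lemma inner_norm V (x : V) : inner x x = (hnorm x ^+ 2)%:C.
Proof. by rewrite -normr_inner hnormE rmorphXn. Qed.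

Lemma inner_ge0 V (x : V) : 0 <= inner x x.
Proof. by rewrite inner_norm ler0c sqr_ge0. Qed.

Lemma cauchy_schwarz V (x y : V) : `|inner x y| <= (hnorm x * hnorm y)%:C.
Proof.
have [y0|y0] := eqVneq (hnorm y) 0.
  by rewrite (hnorm_eq0 y0) linear0r hnorm0 mulr0 normr0.
have yC : (hnorm y)%:C != 0 :> R[i] by rewrite (inj_eq (@complexI R)).
(* The squared distance from x to the line spanned by y is nonnegative. *)
have := inner_ge0 (x - (inner x y / inner y y) *: y).
rewrite linearBl !linearBr /= !innerZl !innerZr.
rewrite [inner y x]innerC rmorphM fmorphV /= -(innerC y y).
rewrite !inner_norm.
have -> : ((hnorm x ^+ 2)%:C - (inner x y)^* / (hnorm y ^+ 2)%:C * inner x y -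
  (inner x y / (hnorm y ^+ 2)%:C * (inner x y)^*  -
   inner x y / (hnorm y ^+ 2)%:C *
   ((inner x y)^* / (hnorm y ^+ 2)%:C * (hnorm y ^+ 2)%:C)) =
  (hnorm x ^+ 2)%:C - `|inner x y| ^+ 2 / (hnorm y ^+ 2)%:C)%R.
  rewrite normCK mulfVK ?rmorphXn ?expf_neq0 //=.
  by rewrite subrr subr0 mulrAC [X in X / _]mulrC.
rewrite subr_ge0 ler_pdivrMr; last by rewrite ltcR exprn_gt0 // lt_def y0 hnorm_ge0.
rewrite -rmorphM -exprMn rmorphXn /= ler_sqr //.
by rewrite nnegrE ler0c mulr_ge0 ?hnorm_ge0.
Qed.

(** The form in which limiting arguments on inner products are concluded. *)
Lemma small_eq0 (z : R[i]) (B : R) : 0 <= B ->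
  (forall e : R, 0 < e -> `|z| <= (e * B)%:C) -> z = 0.
Proof.
move=> B0 h; apply/Normc.eq0_normc/eqP/contraT => t0.
set t := Normc.normc z in t0; have tE : t%:C = `|z| by [].
have tp : 0 < t by rewrite lt_def t0 -ler0c tE normr_ge0.
have B1 : 0 < B + 1 by rewrite ltr_wpDl.
have := h (t / (B + 1)); rewrite -tE lecR divr_gt0 // => /(_ isT).
by rewrite mulrAC ler_pdivlMr // ler_pM2l // gerDl ler10.
Qed.

Lemma inner_injr V (y z : V) : (forall x, inner x y = inner x z) -> y = z.
Proof.
move=> h; apply/eqP; rewrite -subr_eq0; apply/eqP/hnorm_eq0/eqP.
rewrite -sqrf_eq0 -(inj_eq (@complexI R)) -inner_norm linearBr /=.
by rewrite h subrr.
Qed.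

(** The norm of a Hilbert space takes its values in R[i]; here and in the next two
    lemmas convergence, completeness and density are restated with real epsilons. *)
Lemma hnorm_cvgP V (u : nat -> V) (l : V) :
  u @ \oo --> l <->
  forall e : R, 0 < e -> exists N, forall n, (N <= n)%N -> hnorm (u n - l) < e.
Proof.
split=> [/cvgrPdist_lt h e e0|h].
  have [|N _ hN] := h e%:C; first by rewrite ltcR.
  by exists N => n /hN; rewrite /= distrC hnormE ltcR.
apply/cvgrPdist_lt => e e0.
have eR : (complex.Re e)%:C = e by rewrite RRe_real // gtr0_real.
have [|N hN] := h (complex.Re e); first by rewrite -ltcR eR.
by exists N => // n /hN; rewrite /= -eR distrC hnormE ltcR.
Qed.

Lemma hnorm_complete V (u : nat -> V) :
  (forall e : R, 0 < e -> exists N, forall m, (N <= m)%N -> hnorm (u m - u N) < e) ->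
  exists l : V, u @ \oo --> l.
Proof.
move=> h; exists (lim (u @ \oo)).
apply/(@cauchy_cvgP V (u @ \oo))/cauchyP => e e0.
have eR : (complex.Re e)%:C = e by rewrite RRe_real // gtr0_real.
have [|N hN] := h (complex.Re e); first by rewrite -ltcR eR.
exists (u N); exists N => // n /hN; rewrite /= -ball_normE /= -eR distrC.
by rewrite hnormE ltcR.
Qed.

Lemma hnorm_dense V (S : set V) : dense S <->
  forall (v : V) (e : R), 0 < e -> exists2 s, S s & hnorm (v - s) < e.
Proof.
split=> [h v e e0|h O [v Ov] oO].
  
  have Oe : ball v e%:C !=set0 by exists v; apply: ballxx; rewrite ltcR.
  have [s [/= hs Ss]] := h _ Oe (ball_open v e%:C).
  by exists s => //; move: hs; rewrite -ball_normE /= hnormE ltcR.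
have /nbhs_ballP [e /= e0 he] : nbhs v O by apply: open_nbhs_nbhs.
have eR : (complex.Re e)%:C = e by rewrite RRe_real // gtr0_real.
have [|s Ss hs] := h v (complex.Re e); first by rewrite -ltcR eR.
by exists s; split => //; apply: he; rewrite -ball_normE /= hnormE -eR ltcR.
Qed.

End HilbertBasics.

(** * Bounded operators: norm bounds, limits, extension by density *)

Section Operators.
Context {R : realType}.
Implicit Types (U V W : hilbertType R).

Lemma near_natSinv (e : R) : 0 < e ->
  exists N, forall n, (N <= n)%N -> n.+1%:R^-1 < e.
Proof.
move=> e0; have [N _ hN] := near_infty_natSinv_lt (PosNum e0).
by exists N => n /hN.
Qed.

Lemma hnorm_cvg V (u : nat -> V) (l : V) :
  u @ \oo --> l -> (fun n => hnorm (u n)) @ \oo --> hnorm l.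
Proof.
move=> /hnorm_cvgP h; apply/cvgrPdist_lt => e e0.
have [N hN] := h _ e0; exists N => // n /= /hN; apply: le_lt_trans.
have h1 := hnorm_dist l 0 (u n); have h2 := hnorm_dist (u n) 0 l.
rewrite !subr0 [hnorm (l - _)]hnormBC in h1 h2.
by rewrite ler_norml; apply/andP; split; lra.
Qed.

Lemma hnorm_cvg_le U V (u : nat -> U) (v : nat -> V) (l : U) (m : V) (c : R) :
  u @ \oo --> l -> v @ \oo --> m ->
  (exists N, forall n, (N <= n)%N -> hnorm (v n) <= c * hnorm (u n)) ->
  hnorm m <= c * hnorm l.
Proof.
move=> /hnorm_cvg hu /hnorm_cvg hv [N hN].
apply: (ler_cvg_to hv (cvgMl_tmp hu)); exists N => // n /= /hN //.
Qed.

Lemma hcvg_unique V (u : nat -> V) (l m : V) :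
  u @ \oo --> l -> u @ \oo --> m -> l = m.
Proof. by apply: cvg_unique; exact: norm_hausdorff. Qed.

Lemma hcvg_eq V (u w : nat -> V) (l : V) :
  (exists N, forall n, (N <= n)%N -> u n = w n) -> u @ \oo --> l -> w @ \oo --> l.
Proof.
move=> [N hN] /hnorm_cvgP h; apply/hnorm_cvgP => e /h [N' hN'].
exists (maxn N N') => n; rewrite geq_max => /andP [Nn N'n].
by rewrite -hN // hN'.
Qed.

(** Explicit bounds are easier to compose than [opnorm], and make sense
    before boundedness is known. *)
Definition opbound U V (f : U -> V) (c : R) : Prop :=
  forall x, hnorm (f x) <= c * hnorm x.

Lemma linear_pack U V (f : U -> V) :
  linear f -> exists g : {linear U -> V}, f = g.
Proof.
move=> lf; pose g : {linear U -> V} := HB.pack f (GRing.isLinear.Build _ _ _ _ f lf).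
by exists g.
Qed.

(** Polarization: two sesquilinear forms with the same diagonal are equal.
    It turns isometries into maps preserving the inner product, and positivity
    into self-adjointness. *)
Lemma polarization U V W (f f' : {linear U -> V}) (h h' : {linear U -> W}) :
  (forall x, inner (f x) (f' x) = inner (h x) (h' x)) ->
  forall x y, inner (f x) (f' y) = inner (h x) (h' y).
Proof.
move=> diag x y.
have key (k : R[i]) :
    k * inner (f y) (f' x) + k^*%R * inner (f x) (f' y) =
    k * inner (h y) (h' x) + k^*%R * inner (h x) (h' y).
  have := diag (k *: y + x).
  rewrite [f (_ + _)]linearP [f' (_ + _)]linearP [h (_ + _)]linearP.
  rewrite [h' (_ + _)]linearP !innerPl !innerPr !diag => e.
  apply/eqP; rewrite -subr_eq0; apply/eqP.
  rewrite -(subrr (k * (k^*%R * inner (h y) (h' y) + inner (h y) (h' x)) +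
    (k^*%R * inner (h x) (h' y) + inner (h x) (h' x)))).
  by rewrite -[in X in _ = X - _]e; ring.
have := key 'i%C; have := key 1.
have -> : ('i%C : R[i])^*%R = - 'i%C.
  by apply/eqP; rewrite eq_complex /= oppr0 !eqxx.
have i0 : ('i%C : R[i]) != 0 by rewrite eq_complex /= negb_and oner_eq0 orbT.
rewrite rmorph1 !mul1r !mulNr -!mulrBr => h1 /(mulfI i0) h2.
have n2 : (2 : R[i]) != 0 by rewrite pnatr_eq0.
apply: (mulfI n2).
rewrite (_ : 2 * inner (f x) (f' y) =
  (inner (f y) (f' x) + inner (f x) (f' y)) -
  (inner (f y) (f' x) - inner (f x) (f' y))); last by ring.
by rewrite h1 h2; ring.
Qed.

Lemma linear_isometry_inner U V (f : U -> V) : linear_isometry f ->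
  forall x y, inner (f x) (f y) = inner x y.
Proof.
move=> [/linear_pack [g ->] ng]; apply: (@polarization U V U g g idfun idfun) => x.
by rewrite !inner_norm ng.
Qed.

Lemma opbound_opnorm U V (f : U -> V) : bounded_op f -> opbound f (opnorm f).
Proof.
move=> [lf [c hc]] x; have [g fg] := linear_pack lf.
have [x0|x0] := eqVneq (hnorm x) 0.
  by rewrite (hnorm_eq0 x0) fg linear0 !hnorm0 mulr0.
have xp : 0 < hnorm x by rewrite lt_def x0 hnorm_ge0.
rewrite -ler_pdivrMr //.
have nx : hnorm (((hnorm x)^-1)%:C *: x) = 1.
  by rewrite hnormZ_ge0 ?invr_ge0 ?hnorm_ge0 // mulVf.
apply: ub_le_sup.
  exists (Num.max c 0) => _ [y /= y1 <-]; apply: le_trans (hc y) _.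
  rewrite le_max; have [c0|c0] := leP 0 c.
    by rewrite -[X in _ <= X]mulr1 ler_wpM2l.
  by rewrite orbC mulr_le0_ge0 ?hnorm_ge0 // ltW.
exists (((hnorm x)^-1)%:C *: x) => /=; first by rewrite nx.
by rewrite fg linearZ -fg hnormZ_ge0 ?invr_ge0 ?hnorm_ge0 // mulrC.
Qed.

Lemma opnorm_le U V (f : U -> V) (c : R) : 0 <= c -> opbound f c -> opnorm f <= c.
Proof.
move=> c0 h; apply: ge_sup; first by exists (hnorm (f 0)), 0 => //=; rewrite hnorm0.
move=> _ [y /= y1 <-]; apply: le_trans (h y) _.
by rewrite -[leRHS]mulr1 ler_wpM2l.
Qed.

Lemma bounded_opE U V (f : U -> V) (c : R) :
  linear f -> opbound f c -> bounded_op f.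
Proof. by move=> lf h; split=> //; exists c. Qed.

Lemma opbound_ge0 U V (f : U -> V) :
  bounded_op f -> exists c : R, 0 <= c /\ opbound f c.
Proof.
move=> [_ [c hc]]; exists (Num.max c 0); rewrite le_max lexx orbT; split=> // x.
apply: le_trans (hc x) _; rewrite ler_wpM2r ?hnorm_ge0 //.
by rewrite le_max lexx.
Qed.

Lemma opbound_le U V (f : U -> V) (c d : R) :
  opbound f c -> c <= d -> opbound f d.
Proof. by move=> h cd x; apply: le_trans (h x) _; rewrite ler_wpM2r ?hnorm_ge0. Qed.

Lemma opboundD U V (f g : U -> V) (c d : R) :
  opbound f c -> opbound g d -> opbound (f + g) (c + d).
Proof.
move=> hf hg x; apply: le_trans (hnormD _ _) _; rewrite mulrDl.
exact: lerD (hf x) (hg x).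
Qed.

Lemma opboundBC U V (f g : U -> V) (c : R) :
  opbound (f - g) c -> opbound (g - f) c.
Proof. by move=> h x; rewrite -[_ x]/(g x - f x) hnormBC; apply: h. Qed.

Lemma opbound_dist U V (f g h : U -> V) (c d : R) :
  opbound (f - h) c -> opbound (h - g) d -> opbound (f - g) (c + d).
Proof.
by move=> h1 h2; have := opboundD h1 h2; rewrite addrA subrK.
Qed.

Lemma opbound_comp U V W (f : V -> W) (g : U -> V) (c d : R) : 0 <= c ->
  opbound f c -> opbound g d -> opbound (f \o g) (c * d).
Proof.
move=> c0 hf hg x; apply: le_trans (hf _) _; rewrite -mulrA.
by rewrite ler_wpM2l.
Qed.

Lemma opboundZ U V (a : R[i]) (f : U -> V) (c : R) :
  opbound f c -> opbound (a *: f) (Normc.normc a * c).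
Proof.
move=> hf x; rewrite hnormZ -mulrA ler_wpM2l //.
by rewrite -ler0c (_ : (Normc.normc a)%:C = `|a|).
Qed.

(** From |g y|^2 = <f (g y), y> and the Cauchy-Schwarz inequality. *)
Lemma adjoint_opbound V (f g : V -> V) (c : R) : 0 <= c ->
  adjoint_op f g -> opbound f c -> opbound g c.
Proof.
move=> c0 adj hc y; have [y0|y0] := eqVneq (hnorm (g y)) 0.
  by rewrite y0 mulr_ge0 ?hnorm_ge0.
have yp : 0 < hnorm (g y) by rewrite lt_def y0 hnorm_ge0.
rewrite -(ler_pM2l yp) -expr2 -lecR -inner_norm -adj.
have := cauchy_schwarz (f (g y)) y.
rewrite ger0_norm; last by rewrite adj inner_ge0.
move=> h; apply: le_trans h _; rewrite lecR mulrA [hnorm (g y) * c]mulrC.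
by rewrite ler_wpM2r ?hnorm_ge0.
Qed.

Lemma bounded_op0 U V : bounded_op (0 : U -> V).
Proof.
split=> [a x y|]; first by rewrite /GRing.zero /= scaler0 addr0.
by exists 0 => x; rewrite mul0r hnorm0.
Qed.

Lemma bounded_opD U V (f g : U -> V) :
  bounded_op f -> bounded_op g -> bounded_op (f + g).
Proof.
move=> [lf [c hc]] [lg [d hd]]; apply: bounded_opE (opboundD hc hd).
by move=> a x y; rewrite !fctE lf lg scalerDr addrACA.
Qed.

Lemma bounded_opZ U V (a : R[i]) (f : U -> V) :
  bounded_op f -> bounded_op (a *: f).
Proof.
move=> [lf [c hc]]; apply: bounded_opE (opboundZ a hc).
by move=> b x y; rewrite !fctE lf scalerDr !scalerA mulrC.
Qed.

Lemma bounded_opB U V (f g : U -> V) :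
  bounded_op f -> bounded_op g -> bounded_op (f - g).
Proof.
move=> bf bg; have -> : f - g = f + (-1 : R[i]) *: g by rewrite scaleN1r.
by apply: bounded_opD => //; apply: bounded_opZ.
Qed.

Lemma bounded_op_comp U V W (f : V -> W) (g : U -> V) :
  bounded_op f -> bounded_op g -> bounded_op (f \o g).
Proof.
move=> bf [lg [d hd]]; have [c [c0 hc]] := opbound_ge0 bf.
by apply: bounded_opE (opbound_comp c0 hc hd) => a x y /=; rewrite lg bf.1.
Qed.

Lemma bounded_op_cvg U V (f : U -> V) (u : nat -> U) (l : U) :
  bounded_op f -> u @ \oo --> l -> (fun n => f (u n)) @ \oo --> f l.
Proof.
move=> bf /hnorm_cvgP h; have [c [c0 hc]] := opbound_ge0 bf.
have [g fg] := linear_pack bf.1.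
apply/hnorm_cvgP => e e0; have [|N hN] := h (e / (c + 1)).
  by rewrite divr_gt0 // ltr_wpDl.
exists N => n /hN hn; rewrite fg -linearB -fg; apply: le_lt_trans (hc _) _.
rewrite ltr_pdivlMr ?ltr_wpDl // in hn; apply: le_lt_trans hn.
by rewrite mulrC ler_wpM2l ?hnorm_ge0 // lerDl.
Qed.

Lemma opbound_lim U V (f : nat -> U -> V) (g h : U -> V) (c : R) :
  (forall v, (fun n => f n v) @ \oo --> g v) ->
  (exists N, forall n, (N <= n)%N -> opbound (f n - h) c) -> opbound (g - h) c.
Proof.
move=> fg [N hN] v; have cv : (fun _ : nat => v) @ \oo --> v by apply: cvg_cst.
apply: (hnorm_cvg_le cv (cvgB (fg v) (cvg_cst (h v)))).
by exists N => n /hN; apply.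
Qed.

(** Completeness of the bounded operators.  The limit is also given pointwise,
    since algebraic identities pass to the limit more easily in that form. *)
Lemma op_complete U V (F : nat -> U -> V) (r : nat -> R) :
  (forall p, bounded_op (F p)) ->
  (forall e, 0 < e -> exists p, r p < e) ->
  (forall p q, (p <= q)%N -> opbound (F q - F p) (r p)) ->
  exists X, [/\ bounded_op X, forall v, (fun p => F p v) @ \oo --> X v
             & forall p, opbound (X - F p) (r p)].
Proof.
move=> bF r0 hF.
have /choice [X XP] : forall v, exists l : V, (fun p => F p v) @ \oo --> l.
  move=> v; apply: hnorm_complete => e e0.
  have [|N hN] := r0 (e / (hnorm v + 1)).
    by rewrite divr_gt0 // ltr_wpDl ?hnorm_ge0.
  exists N => m Nm; apply: le_lt_trans (hF _ _ Nm v) _.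
  rewrite ltr_pdivlMr ?ltr_wpDl ?hnorm_ge0 // in hN.
  have [rN|rN] := leP 0 (r N).
    by apply: le_lt_trans hN; rewrite ler_wpM2l // lerDl.
  by apply: le_lt_trans e0; rewrite mulr_le0_ge0 ?hnorm_ge0 // ltW.
have XF p : opbound (X - F p) (r p).
  by apply: opbound_lim XP _; exists p => n /hF.
exists X; split=> //; apply: (@bounded_opE _ _ _ (r 0%N + opnorm (F 0%N))).
  move=> a x y; apply: hcvg_unique (XP _) _.
  have -> : F^~ (a *: x + y) = (fun p => a *: F p x + F p y).
    by apply/funext => p; rewrite (bF p).1.
  by apply: cvgD (XP y); apply: cvgZl_tmp.
have := opboundD (XF 0%N) (opbound_opnorm (bF 0%N)).
by rewrite subrK.
Qed.

(** A linear relation with dense domain and bound c extends to a bounded operator: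
    its closure is the graph of a function.  Relations, rather than functions,
    allow operators to be prescribed on a redundant family of vectors (elementary
    tensors); the bound contains the well-definedness. *)
Lemma op_extension U V (G : U -> V -> Prop) (c : R) : 0 <= c ->
  (forall a u v u' v', G u v -> G u' v' -> G (a *: u + u') (a *: v + v')) ->
  (forall u v, G u v -> hnorm v <= c * hnorm u) ->
  (forall u e, 0 < e -> exists u' v, G u' v /\ hnorm (u - u') < e) ->
  exists X, [/\ linear X, opbound X c & forall u v, G u v -> X u = v].
Proof.
move=> c0 Glin Gc Gd.
(* The closure of G, described by sequences. *)
pose C (u : U) (v : V) := exists s t, [/\ forall n : nat, G (s n) (t n),
  s @ \oo --> u & t @ \oo --> v].
have Clin a u v u' v' : C u v -> C u' v' -> C (a *: u + u') (a *: v + v').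
  move=> [s [t [h1 h2 h3]]] [s' [t' [h1' h2' h3']]].
  exists (fun n => a *: s n + s' n), (fun n => a *: t n + t' n); split.
  - by move=> n; apply: Glin.
  - by apply: cvgD h2'; apply: cvgZl_tmp.
  - by apply: cvgD h3'; apply: cvgZl_tmp.
have Cc u v : C u v -> hnorm v <= c * hnorm u.
  move=> [s [t [h1 h2 h3]]]; apply: (hnorm_cvg_le h2 h3).
  by exists 0%N => n _; apply: Gc.
have Cuniq u v v' : C u v -> C u v' -> v = v'.
  move=> h h'; have := Clin (-1) _ _ _ _ h' h => /Cc.
  rewrite !scaleN1r addNr hnorm0 mulr0 => hl.
  have /hnorm_eq0 h0 : hnorm (- v' + v) = 0.
    by apply/le_anti; rewrite hl hnorm_ge0.
  by apply/eqP; rewrite -subr_eq0 addrC h0.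
have /choice [X XP] u : exists v, C u v.
  have /choice [s sP] n : exists u' : U, exists v,
      G u' v /\ hnorm (u - u') < n.+1%:R^-1.
    by apply: Gd; rewrite invr_gt0.
  have /choice [t tP] := sP.
  have su : s @ \oo --> u.
    apply/hnorm_cvgP => e /near_natSinv [N hN]; exists N => n /hN.
    by apply: lt_trans; rewrite hnormBC; case: (tP n).
  have [v tv] : exists v : V, t @ \oo --> v.
    apply: hnorm_complete => e e0.
    have [|N hN] := @near_natSinv (e / (c + 1) / 2).
      by rewrite !divr_gt0 // ltr_wpDl.
    exists N => m Nm.
    have := Glin (-1) _ _ _ _ (tP N).1 (tP m).1 => /Gc; rewrite !scaleN1r.
    rewrite ![- _ + _]addrC => h; apply: le_lt_trans h _.
    have h1 := lt_trans (tP m).2 (hN _ Nm).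
    have h2 := lt_trans (tP N).2 (hN _ (leqnn N)).
    have h3 : hnorm (s m - s N) < e / (c + 1).
      apply: le_lt_trans (hnorm_dist (s m) (s N) u) _.
      by rewrite [X in X + _]hnormBC; move: h1 h2; lra.
    rewrite ltr_pdivlMr ?ltr_wpDl // in h3; apply: le_lt_trans h3.
    by rewrite mulrC ler_wpM2l ?hnorm_ge0 // lerDl.
  by exists v, s, t; split=> // n; case: (tP n).
exists X; split=> [a x y|x|u v Guv]; last 2 first.
- exact: Cc.
- apply: Cuniq (XP u) _; exists (fun=> u), (fun=> v).
  by split=> //; apply: cvg_cst.
- by apply: Cuniq (XP _) _; apply: Clin.
Qed.

Lemma opbound_dense U V (f : U -> V) (D : set U) (c : R) :
  bounded_op f -> (forall u e, 0 < e -> exists2 d, D d & hnorm (u - d) < e) ->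
  (forall d, D d -> hnorm (f d) <= c * hnorm d) -> opbound f c.
Proof.
move=> bf hD hf u.
have /choice [s sP] n : exists d, D d /\ hnorm (u - d) < n.+1%:R^-1.
  by have [|d] := hD u n.+1%:R^-1; [rewrite invr_gt0|exists d].
have su : s @ \oo --> u.
  apply/hnorm_cvgP => e /near_natSinv [N hN]; exists N => n /hN.
  by apply: lt_trans; rewrite hnormBC; case: (sP n).
apply: (hnorm_cvg_le su (bounded_op_cvg bf su)).
by exists 0%N => n _; apply: hf; case: (sP n).
Qed.

(** Both sides are Lipschitz in x. *)
Lemma inner_dense U V (f : U -> V) (D : set U) (v : V) (u : U) :
  bounded_op f -> (forall u e, 0 < e -> exists2 d, D d & hnorm (u - d) < e) ->
  (forall d, D d -> inner (f d) v = inner d u) ->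
  forall x, inner (f x) v = inner x u.
Proof.
move=> bf hD hf x; have [c [c0 hc]] := opbound_ge0 bf.
have [g fg] := linear_pack bf.1; rewrite fg in hc hf *.
apply/eqP; rewrite -subr_eq0; apply/eqP.
apply: (@small_eq0 _ _ (c * hnorm v + hnorm u)) => [|e e0].
  by rewrite addr_ge0 ?mulr_ge0 ?hnorm_ge0.
have [d Dd /ltW hd] := hD x e e0.
have -> : inner (g x) v - inner x u = inner (g (x - d)) v - inner (x - d) u.
  rewrite [g (x - d)]linearB [X in _ = X - _]linearBl [X in _ = _ - X]linearBl /=.
  by rewrite (hf d Dd); ring.
apply: le_trans (ler_normB _ _) _.
apply: (@le_trans _ _ (hnorm (x - d) * (c * hnorm v + hnorm u))%:C); last first.
  by rewrite lecR ler_wpM2r // addr_ge0 ?mulr_ge0 ?hnorm_ge0.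
rewrite mulrDr rmorphD /= lerD ?cauchy_schwarz //.
apply: le_trans (cauchy_schwarz _ _) _.
by rewrite lecR mulrA ler_wpM2r ?hnorm_ge0 // mulrC hc.
Qed.

Lemma adjoint_dense U V (f : U -> V) (g : V -> U) (D : set U) (E : set V) :
  bounded_op f -> bounded_op g ->
  (forall u e, 0 < e -> exists2 d, D d & hnorm (u - d) < e) ->
  (forall u e, 0 < e -> exists2 d, E d & hnorm (u - d) < e) ->
  (forall d e, D d -> E e -> inner (f d) e = inner d (g e)) ->
  forall x y, inner (f x) y = inner x (g y).
Proof.
move=> bf bg hD hE h x y.
rewrite [LHS]innerC [RHS]innerC; congr (_ ^*%R).
apply/esym; apply: (inner_dense bg hE) => e Ee.
rewrite [LHS]innerC [RHS]innerC; congr (_ ^*%R).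
by apply/esym; apply: (inner_dense bf hD) => d Dd; apply: h.
Qed.

End Operators.

(** * Finite-dimensional Hilbert spaces *)

Section FiniteDim.
Context {R : realType}.
Implicit Types (V : finHilbertType R).

(** Gram-Schmidt.  The invariant says only that the projection onto the span of e
    fixes e and s; fixing e already makes v minus its projection orthogonal to e. *)
Lemma parseval_seq V (s : seq V) : exists e : seq V,
  (forall b, b \in e -> \sum_(a <- e) inner b a *: a = b) /\
  (forall b, b \in s -> \sum_(a <- e) inner b a *: a = b).
Proof.
elim: s => [|v s [e [he hs]]]; first by exists [::].
pose u := v - \sum_(a <- e) inner v a *: a.
have ue b : b \in e -> inner u b = 0.
  move=> be; rewrite linearBl /= inner_suml -[in inner v b](he b be) inner_sumr.
  apply/eqP; rewrite subr_eq0; apply/eqP/eq_bigr => a _.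
  by rewrite innerZl innerZr -innerC mulrC.
have [u0|u0] := eqVneq u 0.
  exists e; split=> // b; rewrite inE => /predU1P [->|/hs //].
  exact/esym/subr0_eq.
have nu : hnorm u != 0 by apply: contraNneq u0 => /hnorm_eq0 ->.
pose w := ((hnorm u)^-1)%:C *: u.
have we b : b \in e -> inner b w = 0.
  by move=> /ue h; rewrite innerC innerZl h mulr0 rmorph0.
have ww : inner w w = 1.
  rewrite inner_norm hnormZ_ge0 ?invr_ge0 ?hnorm_ge0 // mulVf //.
  by rewrite expr1n.
have ew b : \sum_(a <- e) inner b a *: a = b -> inner b w = 0.
  move=> <-; rewrite inner_suml big_seq big1 // => a ae.
  by rewrite innerZl we ?mulr0.
exists (w :: e); split=> b; rewrite inE => /predU1P [->|bs]; rewrite big_cons.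
- rewrite ww scale1r big_seq big1 ?addr0 // => a ae.
  by rewrite innerC we // rmorph0 scale0r.
- by rewrite we // scale0r add0r he.
- have vE : v = u + \sum_(a <- e) inner v a *: a by rewrite subrK.
  have -> : inner v w = (hnorm u)%:C.
    rewrite [in LHS]vE linearDl /= inner_suml [X in _ + X]big_seq big1; last first.
      by move=> a ae; rewrite innerZl we ?mulr0.
    rewrite addr0 innerZr inner_norm.
    have -> : (((hnorm u)^-1)%:C)^*%R = ((hnorm u)^-1)%:C := conjc_real _.
    by rewrite -rmorphM expr2 /= mulKf.
  by rewrite scalerA -rmorphM mulfV // rmorph1 scale1r -vE.
- by rewrite ew ?scale0r ?add0r hs.
Qed.

Lemma parseval V : exists e : seq V, forall x : V, x = \sum_(a <- e) inner x a *: a.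
Proof.
have [e [_ he]] := parseval_seq (vbasis (@fullv _ V)).
exists e => x; rewrite [in LHS](coord_vbasis (memvf x)).
rewrite [in RHS](coord_vbasis (memvf x)).
under [RHS]eq_bigr do rewrite inner_suml scaler_suml.
rewrite exchange_big /=; apply: eq_bigr => i _.
under eq_bigr do rewrite innerZl -scalerA.
by rewrite -scaler_sumr he // mem_nth // size_tuple.
Qed.

Lemma parseval_inner V : exists e : seq V, forall x y : V,
  inner x y = \sum_(a <- e) inner x a * (inner y a)^*%R.
Proof.
have [e he] := parseval V; exists e => x y.
rewrite [in LHS](he x) inner_suml; apply: eq_bigr => a _.
by rewrite innerZl [inner a y]innerC.
Qed.

(** The adjoint is y |-> sum_a <y, S a> a for a as in Parseval's identity. *)
Lemma adjoint_fin V (S : V -> V) : bounded_op S ->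
  exists S', bounded_op S' /\ adjoint_op S S'.
Proof.
move=> bS; have [c [c0 hc]] := opbound_ge0 bS.
have [g gS] := linear_pack bS.1.
have [e he] := parseval V.
pose S' y := \sum_(a <- e) inner y (S a) *: a.
have adj : adjoint_op S S'.
  move=> x y; rewrite [in LHS](he x) gS linear_sum inner_suml inner_sumr.
  apply: eq_bigr => a _; rewrite linearZ innerZl innerZr -gS mulrC.
  by rewrite [inner (S a) y]innerC.
exists S'; split=> //; apply: (bounded_opE _ (adjoint_opbound c0 adj hc)).
move=> a x y; rewrite /S' scaler_sumr -big_split; apply: eq_bigr => b _ /=.
by rewrite innerPl scalerDl scalerA.
Qed.

Lemma positive_selfadjoint V (A : V -> V) : positive_op A -> adjoint_op A A.
Proof.
move=> [bA pA]; have [g gA] := linear_pack bA.1; rewrite gA in pA *.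
rewrite /adjoint_op; apply: (@polarization _ V V V g idfun idfun g) => x.
by rewrite [RHS]innerC; apply/esym/CrealP/ger0_real.
Qed.

End FiniteDim.

(** * Norms of tensor products of operators *)

Section Kernels.
Context {R : realType} {X : Type}.
Implicit Types (k : X -> X -> R[i]).

(** Positive semidefinite kernels.  The quadratic form is taken on formal linear
    combinations, encoded as lists of (coefficient, point), possibly with
    repeated points, so that X may be any type. *)
Definition psd k := forall s : seq (R[i] * X),
  0 <= \sum_(p <- s) \sum_(q <- s) p.1 * q.1^*%R * k p.2 q.2.

Lemma psdD k l : psd k -> psd l -> psd (fun x y => k x y + l x y).
Proof.
move=> hk hl s; have := addr_ge0 (hk s) (hl s); rewrite -big_split /=.
under eq_bigr do rewrite -big_split /=.
by under eq_bigr do under eq_bigr do rewrite -mulrDr.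
Qed.

Lemma gramE (V : hilbertType R) (f : X -> V) (s : seq (R[i] * X)) :
  \sum_(p <- s) \sum_(q <- s) p.1 * q.1^*%R * inner (f p.2) (f q.2) =
  (hnorm (\sum_(p <- s) p.1 *: f p.2) ^+ 2)%:C.
Proof.
rewrite -inner_norm inner_suml; apply: eq_bigr => p _.
rewrite inner_sumr; apply: eq_bigr => q _.
by rewrite innerZl innerZr mulrA.
Qed.

(** The quadratic form is c^2 |v|^2 - |S v|^2, where v is the given combination
    of the f x. *)
Lemma psd_gramB (V : finHilbertType R) (f : X -> V) (S : V -> V) (c : R) :
  0 <= c -> linear S -> opbound S c ->
  psd (fun x y => (c ^+ 2)%:C * inner (f x) (f y) - inner (S (f x)) (S (f y))).
Proof.
move=> c0 lS hS s; have [g gS] := linear_pack lS.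
under eq_bigr do under eq_bigr do rewrite mulrBr mulrCA.
under eq_bigr do rewrite sumrB -mulr_sumr.
rewrite sumrB -mulr_sumr subr_ge0 (gramE (S \o f)) gramE.
rewrite -rmorphM lecR -exprMn.
rewrite ler_sqr ?nnegrE ?mulr_ge0 ?hnorm_ge0 //.
apply: le_trans (hS _); rewrite gS linear_sum /=.
by under [in leRHS]eq_bigr do rewrite linearZ.
Qed.

(** Schur's product theorem when one factor is a Gram kernel.  By Parseval's
    identity <f x, f y> = sum_a <f x, a> <f y, a>^*, and each term just
    rescales the coefficients in the quadratic form of k. *)
Lemma psd_schur (V : finHilbertType R) (f : X -> V) k :
  psd k -> psd (fun x y => inner (f x) (f y) * k x y).
Proof.
move=> hk s; have [e he] := parseval_inner V.
have -> : \sum_(p <- s) \sum_(q <- s)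
    p.1 * q.1^*%R * (inner (f p.2) (f q.2) * k p.2 q.2) =
  \sum_(a <- e) \sum_(p <- [seq (p.1 * inner (f p.2) a, p.2) | p <- s])
    \sum_(q <- [seq (q.1 * inner (f q.2) a, q.2) | q <- s])
      p.1 * q.1^*%R * k p.2 q.2.
  under [RHS]eq_bigr do rewrite big_map.
  rewrite [RHS]exchange_big; apply: eq_bigr => p _ /=.
  under [RHS]eq_bigr do rewrite big_map.
  rewrite [RHS]exchange_big; apply: eq_bigr => q _ /=.
  rewrite he mulr_suml mulr_sumr; apply: eq_bigr => a _.
  by rewrite rmorphM /=; ring.
by apply: sumr_ge0 => a _; apply: hk.
Qed.

End Kernels.

Section FiniteTensor.
Context {R : realType} {I : finType} {H : I -> finHilbertType R}.
Variable T : tensor_product H.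
Implicit Types (S : forall i, H i -> H i).

Lemma psd_prod_schur (k : (forall i, H i) -> (forall i, H i) -> R[i]) (r : seq I) :
  psd k -> psd (fun x y => (\prod_(i <- r) inner (x i) (y i)) * k x y).
Proof.
move=> hk; elim: r => [|i r IH].
  move=> s; have := hk s; congr (0 <= _); apply: eq_bigr => p _.
  by apply: eq_bigr => q _; rewrite big_nil mul1r.
have := @psd_schur _ _ _ (fun x => x i) _ IH.
move=> h s; have := h s; congr (0 <= _); apply: eq_bigr => p _.
by apply: eq_bigr => q _; rewrite big_cons !mulrA.
Qed.

(** By induction on the number of factors, writing (c a)(C P) - b Q as
    C P (c a - b) + b (C P - Q), where a, b, P and Q are Gram kernels and products
    of Gram kernels; both summands are positive by Schur's theorem. *)
Lemma psd_prodB S (C : I -> R) (r : seq I) :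
  (forall i, 0 <= C i) -> (forall i, linear (S i)) ->
  (forall i, opbound (S i) (C i)) ->
  psd (fun x y => (\prod_(i <- r) C i ^+ 2)%:C * (\prod_(i <- r) inner (x i) (y i))
                   - \prod_(i <- r) inner (S i (x i)) (S i (y i))).
Proof.
move=> C0 lS hS; elim: r => [|i r IH].
  move=> s; rewrite big1 // => p _; rewrite big1 // => q _.
  by rewrite !big_nil mul1r subrr mulr0.
have h1 := psd_schur (fun x : forall i, H i => S i (x i)) IH.
have h2 := @psd_prod_schur _ r
  (psd_gramB (fun x : forall i, H i => x i) (C0 i) (lS i) (hS i)).
have h3 : psd (fun x y : forall i, H i => (\prod_(i <- r) C i ^+ 2)%:C *
   ((\prod_(i <- r) inner (x i) (y i)) * 
     ((C i ^+ 2)%:C * inner (x i) (y i) - inner (S i (x i)) (S i (y i))))).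
  move=> s /=; under eq_bigr do under eq_bigr do rewrite mulrCA.
  under eq_bigr do rewrite -mulr_sumr.
  rewrite -mulr_sumr mulr_ge0 //.
  by rewrite ler0c prodr_ge0 // => j _; rewrite sqr_ge0.
move=> s; have := psdD h3 h1 s; congr (0 <= _).
apply: eq_bigr => p _. apply: eq_bigr => q _ /=. congr (_ * _).
by rewrite !big_cons rmorphM /=; ring.
Qed.

Definition tens_comb (s : seq (R[i] * (forall i, H i))) : T :=
  \sum_(p <- s) p.1 *: tens T p.2.

Definition tens_map S (s : seq (R[i] * (forall i, H i))) :=
  [seq (p.1, (fun i => S i (p.2 i)) : forall i, H i) | p <- s].

Lemma tens_comb_span (z : T) : exists s, z = tens_comb s.
Proof.
have [r [c [x ->]]] := tens_span z.
exists [seq (c j, x j) | j <- enum 'I_r].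
by rewrite /tens_comb big_map big_enum.
Qed.

Lemma gram_tens Y (F : Y -> forall i, H i) (s : seq (R[i] * Y)) :
  \sum_(p <- s) \sum_(q <- s) p.1 * q.1^*%R * (\prod_i inner (F p.2 i) (F q.2 i)) =
  (hnorm (\sum_(p <- s) p.1 *: tens T (F p.2)) ^+ 2)%:C.
Proof.
rewrite -(gramE (fun y => tens T (F y))).
by apply: eq_bigr => p _; apply: eq_bigr => q _; rewrite inner_tens.
Qed.

(** The norm inequality for a product of operators, before the product operator
    is known to exist: [psd_prodB] evaluated on the combination s. *)
Lemma tens_comb_bound S (C : I -> R) s :
  (forall i, 0 <= C i) -> (forall i, linear (S i)) ->
  (forall i, opbound (S i) (C i)) ->
  hnorm (tens_comb (tens_map S s)) <= (\prod_i C i) * hnorm (tens_comb s).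
Proof.
move=> C0 lS hS; have /= := psd_prodB (index_enum I) C0 lS hS s.
under eq_bigr do under eq_bigr do rewrite mulrBr mulrCA.
under eq_bigr do rewrite sumrB -mulr_sumr.
rewrite sumrB -mulr_sumr subr_ge0.
rewrite (gram_tens (fun x => x)) (gram_tens (fun x i => S i (x i))).
rewrite /tens_comb big_map -rmorphM lecR prodrXl -exprMn.
by rewrite ler_sqr ?nnegrE ?mulr_ge0 ?hnorm_ge0 ?prodr_ge0.
Qed.

Lemma tensor_op_exists S (C : I -> R) :
  (forall i, 0 <= C i) -> (forall i, linear (S i)) ->
  (forall i, opbound (S i) (C i)) ->
  exists P : T -> T, is_tensor_op S P /\ opbound P (\prod_i C i).
Proof.
move=> C0 lS hS.
pose G u v := exists s, u = tens_comb s /\ v = tens_comb (tens_map S s).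
have [||||P [lP bP GP]] := @op_extension _ _ _ G (\prod_i C i).
- by rewrite prodr_ge0.
- move=> a _ _ _ _ [s [-> ->]] [t [-> ->]].
  exists ([seq (a * p.1, p.2) | p <- s] ++ t).
  rewrite /tens_comb /tens_map map_cat !big_cat !big_map !scaler_sumr /=.
  by split; congr (_ + _); apply: eq_bigr => p _; rewrite scalerA.
- by move=> _ _ [s [-> ->]]; apply: tens_comb_bound.
- move=> u e e0; have [s us] := tens_comb_span u.
  exists u, (tens_comb (tens_map S s)); rewrite subrr hnorm0; split=> //.
  by exists s.
exists P; split=> //; split=> // x; apply: GP; exists [:: (1, x)].
by rewrite /tens_comb /tens_map /= !big_seq1 !scale1r.
Qed.

End FiniteTensor.

(** * Operators on the infinite tensor product *)

Section InfTensor.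
Context {R : realType} {H : nat -> finHilbertType R}.
Context {xi : forall n, H n}.
Context {T : forall n, tensor_product (fun k : 'I_n.+1 => H k)}.
Context {phi : forall n m, T n -> T m}.
Hypothesis phi_embedding : forall n m, (n < m)%N ->
  is_tensor_embedding xi (@phi n m).
Context {K : limit_completion phi}.
Implicit Types (x : forall k, H k) (S : forall k, H k -> H k) (X Y : K -> K).

(** The elementary tensor x 0, ..., x n, xi (n+1), xi (n+2), ... of the limit space.
    Factors are given by sequences over all of nat, so that levels can vary
    without dependent casts. *)
Definition etens n x : K := lc_incl K (tens (T n) (fun k : 'I_n.+1 => x k)).

Definition pad n x : forall k, H k := fun k => if (k <= n)%N then x k else xi k.

Definition ecomb n (s : seq (R[i] * (forall k, H k))) : K :=
  \sum_(p <- s) p.1 *: etens n p.2.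

Definition emap S (s : seq (R[i] * (forall k, H k))) :=
  [seq (p.1, (fun i => S i (p.2 i)) : forall i, H i) | p <- s].

Definition restr n (s : seq (R[i] * (forall k, H k))) :
    seq (R[i] * (forall k : 'I_n.+1, H k)) :=
  map (fun p : R[i] * (forall k, H k) =>
         (p.1, (fun k => p.2 k) : forall k : 'I_n.+1, H k)) s.

Lemma extend_ord n (x : forall k : 'I_n.+1, H k) :
  exists y : forall k, H k, forall k : 'I_n.+1, y k = x k.
Proof.
(* Away from the given coordinates any vector does; 0 is chosen. *)
have h k : exists u : H k, forall kn : (k < n.+1)%N, u = x (Ordinal kn).
  case: (pselect (k < n.+1)%N) => kn; last by exists 0 => kn'; case: kn.
  by exists (x (Ordinal kn)) => kn'; rewrite (bool_irrelevance kn' kn).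
exists (fun k => projT1 (cid (h k))) => -[k kn] /=.
by case: cid => u /= ->.
Qed.

Lemma incl_lin n : linear (@lc_incl _ _ _ K n).
Proof. by have [] := lc_incl_isometry K n. Qed.

Lemma tens_comb_global n (z : T n) : exists s : seq (R[i] * (forall k, H k)),
  z = tens_comb (T n) (restr n s).
Proof.
have [s ->] := tens_comb_span z; rewrite /tens_comb.
elim: s => [|[c x] s [t IH]]; first by exists [::].
have [y yx] := extend_ord x; exists ((c, y) :: t).
rewrite /= !big_cons IH /=; congr (_ *: tens _ _ + _).
by apply: functional_extensionality_dep => k; rewrite yx.
Qed.

Lemma ecombE n s : ecomb n s =
  lc_incl K (tens_comb (T n) (restr n s)).
Proof.
have [g gE] := linear_pack (incl_lin (n := n)).
rewrite /ecomb /tens_comb /restr big_map gE linear_sum; apply: eq_bigr => p _.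
by rewrite /= linearZ -gE.
Qed.

Lemma incl_ecomb n (z : T n) : exists s, lc_incl K z = ecomb n s.
Proof. by have [s ->] := tens_comb_global z; exists s; rewrite ecombE. Qed.

Lemma ecomb_bound n S (C : nat -> R) s :
  (forall i, 0 <= C i) -> (forall i, linear (S i)) ->
  (forall i, opbound (S i) (C i)) ->
  hnorm (ecomb n (emap S s)) <= (\prod_(i < n.+1) C i) * hnorm (ecomb n s).
Proof.
move=> C0 lS hS; rewrite !ecombE !(lc_incl_isometry K n).2.
have := @tens_comb_bound _ _ _ (T n) (fun k : 'I_n.+1 => S k) (fun k => C k)
  (restr n s) (fun k => C0 k) (fun k => lS k) (fun k => hS k).
by rewrite /tens_map /emap /restr -!map_comp.
Qed.

Lemma incl_raise n m (z : T n) :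
  (n <= m)%N -> exists w : T m, lc_incl K w = lc_incl K z.
Proof.
rewrite leq_eqVlt => /predU1P [nm|nm]; first by case: m / nm; exists z.
by exists (phi m z); rewrite lc_incl_compat.
Qed.

Lemma etens_raise n m x : (n < m)%N -> etens n x = etens m (pad n x).
Proof.
move=> nm; rewrite /etens -(lc_incl_compat _ _ nm) (phi_embedding nm).2.
by [].
Qed.

(** Combinations can be pushed to a higher level by padding with xi, and this
    commutes with S as long as S fixes the xi that are added. *)
Lemma ecomb_raise n m s : (n <= m)%N -> exists t, ecomb n s = ecomb m t /\
  forall S, (forall k, (n < k)%N -> S k (xi k) = xi k) ->
    ecomb n (emap S s) = ecomb m (emap S t).
Proof.
rewrite leq_eqVlt => /predU1P [<-|nm]; first by exists s.
exists [seq (p.1, pad n p.2) | p <- s].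
rewrite /ecomb /emap !big_map; split.
  by apply: eq_bigr => p _; rewrite (etens_raise _ nm).
move=> S hS; rewrite !big_map; apply: eq_bigr => p _; rewrite (etens_raise _ nm) /=.
congr (_ *: etens _ _); apply: functional_extensionality_dep => k.
by rewrite /pad; case: leqP => // /hS ->.
Qed.

Lemma ecomb_dense k (v : K) (e : R) : 0 < e ->
  exists n s, (k <= n)%N /\ hnorm (v - ecomb n s) < e.
Proof.
move=> e0; have /hnorm_dense h := @lc_incl_dense _ _ _ K.
have [_ [n _ [z _ <-]] hz] := h v e e0.
have [w wz] := incl_raise z (leq_maxr k n).
have [s ws] := incl_ecomb w.
by exists (maxn k n), s; rewrite leq_maxl -ws wz.
Qed.

(** Only elementary tensors of high level are constrained: at low levels, padding
    with xi need not commute with S. *)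
Definition acts_as S X := bounded_op X /\ exists k, forall n, (k <= n)%N ->
  forall x, X (etens n x) = etens n (fun i => S i (x i)).

Lemma acts_as_ecomb S X : acts_as S X -> exists k, forall n, (k <= n)%N ->
  forall s, X (ecomb n s) = ecomb n (emap S s).
Proof.
move=> [[lX _] [k hk]]; have [g gX] := linear_pack lX; exists k => n kn s.
rewrite /ecomb big_map gX linear_sum; apply: eq_bigr => p _.
by rewrite linearZ -gX hk.
Qed.

Lemma opbound_ecomb (V : hilbertType R) (f : K -> V) k (c : R) : bounded_op f ->
  (forall n s, (k <= n)%N -> hnorm (f (ecomb n s)) <= c * hnorm (ecomb n s)) ->
  opbound f c.
Proof.
move=> bf h.
apply: (@opbound_dense _ _ _ _ [set u | exists n s, (k <= n)%N /\ u = ecomb n s]) => //.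
  move=> u e e0; have [n [s [kn hs]]] := ecomb_dense k u e0.
  by exists (ecomb n s) => //=; exists n, s.
by move=> _ [n [s [kn ->]]]; apply: h.
Qed.

Lemma acts_as_uniq S X Y : acts_as S X -> acts_as S Y -> X = Y.
Proof.
move=> hX hY; have [k hk] := acts_as_ecomb hX; have [l hl] := acts_as_ecomb hY.
have : opbound (X - Y) 0.
  apply: (opbound_ecomb (k := maxn k l)).
    by apply: bounded_opB; [case: hX|case: hY].
  move=> n s; rewrite geq_max => /andP [kn ln].
  by rewrite !fctE hk // hl // subrr hnorm0 mul0r.
move=> h; apply/funext => v; apply/eqP; rewrite -subr_eq0; apply/eqP/hnorm_eq0.
by apply/le_anti; rewrite hnorm_ge0 andbT; have := h v; rewrite mul0r.
Qed.

Lemma acts_as_bound k0 S X (C : nat -> R) (c : R) : acts_as S X ->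
  (forall i, 0 <= C i) -> (forall i, linear (S i)) ->
  (forall i, opbound (S i) (C i)) ->
  (forall n, (k0 <= n)%N -> \prod_(i < n.+1) C i <= c) ->
  opbound X c.
Proof.
move=> hX C0 lS hS hc; have [k hk] := acts_as_ecomb hX.
apply: (opbound_ecomb (k := maxn k0 k) hX.1) => n s.
rewrite geq_max => /andP [k0n kn]; rewrite hk //.
apply: le_trans (ecomb_bound _ _ C0 lS hS) _.
by rewrite ler_wpM2r ?hnorm_ge0 ?hc.
Qed.

Lemma acts_as_comp S X S' X' : acts_as S X -> acts_as S' X' ->
  acts_as (fun i => S i \o S' i) (X \o X').
Proof.
move=> [bX [k hk]] [bX' [k' hk']]; split; first exact: bounded_op_comp.
exists (maxn k k') => n; rewrite geq_max => /andP [kn kn'] x /=.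
by rewrite hk' // hk.
Qed.

Lemma acts_as_iter S X d : acts_as S X -> acts_as (fun i => iter d (S i)) (iter d X).
Proof.
move=> hX; elim: d => [|d IH]; last exact: (acts_as_comp hX IH).
split; last by exists 0%N.
by split=> [a x y //|]; exists 1 => x; rewrite mul1r.
Qed.

(** Multilinearity: changing a single factor by a difference. *)
Lemma acts_as_diff_coord (p : nat) S S' X X' (D : forall k, H k -> H k) :
  acts_as S X -> acts_as S' X' ->
  (forall i, i != p -> S i = S' i) -> (forall i, i != p -> D i = S i) ->
  (forall u : H p, D p u = S p u - S' p u) ->
  acts_as D (X - X').
Proof.
move=> [bX [k hk]] [bX' [k' hk']] SS DS Dp; split; first exact: bounded_opB.
exists (maxn p (maxn k k')) => n; rewrite !geq_max => /and3P [pn kn kn'] x.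
rewrite !fctE hk // hk' // /etens.
have [g gE] := linear_pack (incl_lin (n := n)); rewrite gE -linearB; congr (g _).
(* The three tensors come from y by changing its p-th entry. *)
pose q : 'I_n.+1 := Ordinal (pn : (p < n.+1)%N).
pose y : forall k : 'I_n.+1, H k := fun k => S k (x k).
have [h hE] := linear_pack (@tens_multilinear _ _ _ (T n) y q).
have hq u : h u = tens (T n) (dfwith y q u) by rewrite -hE.
have tq (f : forall k, H k) : (forall k, k != p -> f k = S k (x k)) ->
    tens (T n) (fun k : 'I_n.+1 => f k) = h (f p).
  move=> hf; rewrite hq; congr (tens _ _).
  apply: functional_extensionality_dep => i.
  have [->|iq] := eqVneq i q; first by rewrite dfwithin.
  by rewrite dfwithout 1?eq_sym // /y hf.
rewrite (tq (fun k => S k (x k))) // (tq (fun k => S' k (x k))); last first.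
  by move=> i ip; rewrite SS.
rewrite (tq (fun k => D k (x k))); last by move=> i ip; rewrite DS.
by rewrite -linearB Dp.
Qed.

(** When S fixes the xi beyond k, the product of the S i is prescribed
    consistently on the elementary tensors of level at least k, and the norm
    inequality lets it extend to the whole space. *)
Lemma acts_as_exists S (C : nat -> R) (c : R) k :
  (forall i, 0 <= C i) -> (forall i, linear (S i)) ->
  (forall i, opbound (S i) (C i)) ->
  (forall n, (k <= n)%N -> \prod_(i < n.+1) C i <= c) ->
  (forall i, (k <= i)%N -> S i (xi i) = xi i) -> exists X, acts_as S X.
Proof.
move=> C0 lS hS hc Sxi.
pose G u v := exists n s, [/\ (k <= n)%N, u = ecomb n s & v = ecomb n (emap S s)].
have Graise n m s : (k <= n)%N -> (n <= m)%N -> exists t,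
    ecomb n s = ecomb m t /\ ecomb n (emap S s) = ecomb m (emap S t).
  move=> kn nm; have [t [h1 h2]] := ecomb_raise s nm; exists t; split=> //.
  by apply: h2 => i ni; apply: Sxi; apply: leq_trans kn (ltnW ni).
have [||||X [lX bX GX]] := @op_extension _ _ _ G c.
- by apply: le_trans (hc k (leqnn k)); rewrite prodr_ge0.
- move=> a _ _ _ _ [n [s [kn -> ->]]] [m [t [km -> ->]]].
  have [s' [-> ->]] := Graise _ _ s kn (leq_maxl n m).
  have [t' [-> ->]] := Graise _ _ t km (leq_maxr n m).
  exists (maxn n m), ([seq (a * p.1, p.2) | p <- s'] ++ t').
  rewrite /ecomb /emap map_cat !big_cat !big_map !scaler_sumr /=.
  split; first by rewrite leq_max kn.
    by congr (_ + _); apply: eq_bigr => p _; rewrite scalerA.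
  by congr (_ + _); apply: eq_bigr => p _; rewrite scalerA.
- move=> _ _ [n [s [kn -> ->]]]; apply: le_trans (ecomb_bound _ _ C0 lS hS) _.
  by rewrite ler_wpM2r ?hnorm_ge0 ?hc.
- move=> u e e0; have [n [s [kn hs]]] := ecomb_dense k u e0.
  by exists (ecomb n s), (ecomb n (emap S s)); split=> //; exists n, s.
exists X; split; first exact: bounded_opE bX.
exists k => n kn x; apply: GX; exists n, [:: (1, x)].
by rewrite /ecomb /emap /= !big_seq1 !scale1r.
Qed.

Lemma acts_as_adjoint S S' X X' : acts_as S X -> acts_as S' X' ->
  (forall i, adjoint_op (S i) (S' i)) -> adjoint_op X X'.
Proof.
move=> hX hX' adj.
have [g gX] := linear_pack hX.1.1; have [g' gX'] := linear_pack hX'.1.1.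
have [k hk] := acts_as_ecomb hX; have [k' hk'] := acts_as_ecomb hX'.
have fin n s t : (k <= n)%N -> (k' <= n)%N ->
    inner (X (ecomb n s)) (ecomb n t) = inner (ecomb n s) (X' (ecomb n t)).
  move=> kn kn'; rewrite hk // hk' // /ecomb !big_map !inner_suml.
  apply: eq_bigr => p _; rewrite !inner_sumr; apply: eq_bigr => q _.
  rewrite !innerZl !innerZr; congr (_ * (_ * _)).
  rewrite /etens !(linear_isometry_inner (lc_incl_isometry K n)) !inner_tens.
  by apply: eq_bigr => i _; rewrite adj.
pose D := [set u : K | exists n s, [/\ (k <= n)%N, (k' <= n)%N & u = ecomb n s]].
have hD (u : K) e : 0 < e -> exists2 d, D d & hnorm (u - d) < e.
  move=> e0; have [n [s [kn hs]]] := ecomb_dense (maxn k k') u e0.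
  move: kn; rewrite geq_max => /andP [kn kn'].
  by exists (ecomb n s) => //; exists n, s.
apply: (adjoint_dense hX.1 hX'.1 hD hD).
move=> _ _ [n [s [kn kn' ->]]] [m [t [km km' ->]]].
have [s' [-> _]] := ecomb_raise s (leq_maxl n m).
have [t' [-> _]] := ecomb_raise t (leq_maxr n m).
by apply: fin; rewrite leq_max ?kn ?kn'.
Qed.

End InfTensor.

(** * Infinite products of operators as norm limits *)

Section Series.
Context {R : realType}.

Lemma prod_eventually1 (F : nat -> R) k n :
  (forall i, (k <= i)%N -> F i = 1) -> (k <= n)%N ->
  \prod_(i < n) F i = \prod_(i < k) F i.
Proof.
move=> h kn; rewrite -!(big_mkord xpredT F) (@big_cat_nat _ _ _ k) //=.
by rewrite [X in _ * X]big_nat_cond [X in _ * X]big1 ?mulr1 // => i /andP [/andP [/h]].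
Qed.

Lemma series_eventually0 (F : nat -> R) k :
  (forall i, (k <= i)%N -> F i = 0) -> cvgn (series F).
Proof.
move=> h; apply/cvg_ex; exists (series F k); apply: cvg_near_cst.
exists k => // n /= kn; rewrite /series /= (@big_cat_nat _ _ _ k) //=.
by rewrite [X in _ + X]big_nat_cond [X in _ + X]big1 ?addr0 // => i /andP [/andP [/h]].
Qed.

Lemma prod_1D_le_expR (d : nat -> R) (l : R) n :
  (forall i, 0 <= d i) -> (forall n, series d n <= l) ->
  \prod_(i < n) (1 + d i) <= expR l.
Proof.
move=> d0 hl; apply: (@le_trans _ _ (expR (series d n))); last by rewrite ler_expR.
rewrite /series /= big_mkord expR_sum; apply: ler_prod => i _.
by rewrite expR_ge1Dx addr_ge0.
Qed.

Lemma series_tail (d : nat -> R) : (forall i, 0 <= d i) -> cvgn (series d) ->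
  (forall n, series d n <= limn (series d)) /\
  forall e, 0 < e ->
    exists N, forall n, (N <= n)%N -> limn (series d) - series d n < e.
Proof.
move=> d0 cd; split=> [n|e e0].
  apply: nondecreasing_cvgn_le cd n => //.
  by apply: nondecreasing_series => i _ _; apply: d0.
have /cvgrPdist_lt /(_ e e0) [N _ hN] := cd.
exists N => n /hN /=; apply: le_lt_trans; exact: ler_norm.
Qed.

End Series.

Definition with_tail (R : realType) (H : nat -> finHilbertType R)
    (S tl : forall i, H i -> H i) (p : nat) : forall i, H i -> H i :=
  fun i => if (i < p)%N then S i else tl i.
Arguments with_tail {R H} S tl p i _.

Section InfLimit.
Context {R : realType} {H : nat -> finHilbertType R}.
Variable A : forall n, H n -> H n.
Arguments A : clear implicits.
Context {xi : forall n, H n}.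
Context {T : forall n, tensor_product (fun k : 'I_n.+1 => H k)}.
Context {phi : forall n m, T n -> T m}.
Hypothesis phi_embedding : forall n m, (n < m)%N ->
  is_tensor_embedding xi (@phi n m).
Context {K : limit_completion phi}.
Hypothesis A_bounded : forall n, bounded_op (A n).
Hypothesis A_norm : forall n, opnorm (A n) = 1.
Hypothesis A_xi : forall n, A n (xi n) = xi n.
Implicit Types (x : forall k, H k) (S : forall k, H k -> H k) (X Y : K -> K).

(** For such S the limit defining the infinite tensor product is eventually
    constant, and so are the two sequences in the admissibility condition. *)
Lemma acts_as_E_set S X k : acts_as S X -> (forall n, bounded_op (S n)) ->
  (forall n, (k <= n)%N -> S n = A n) -> E_set xi A X.
Proof.
move=> hX bS SA; exists S; split; last 1 first.
- split; first exact: hX.1.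
  have /choice [c hc] := fun i => opbound_ge0 (bS i).
  have hP m : exists P : T m -> T m, is_tensor_op (fun k : 'I_m.+1 => S k) P.
    have [P [hP _]] := @tensor_op_exists _ _ _ (T m) (fun k : 'I_m.+1 => S k)
      (fun k => c k) (fun i => (hc i).1) (fun i => (bS i).1) (fun i => (hc i).2).
    by exists P.
  exists (fun m => projT1 (cid (hP m))); split=> [m|n z]; first by case: cid.
  apply: cvg_near_cst; have [l hl] := acts_as_ecomb hX.
  exists (maxn n.+1 l) => // m /=; rewrite geq_max => /andP [nm lm].
  case: cid => P [lP PS] /=.
  rewrite -(lc_incl_compat _ _ nm).
  have [s ->] := tens_comb_global (phi m z).
  rewrite -ecombE hl //.
  have [g gE] := linear_pack (incl_lin (K := K) (n := m)).
  have [h hE] := linear_pack lP.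
  rewrite /ecomb /tens_comb /emap /restr !big_map gE hE !linear_sum.
  apply: eq_bigr => p _ /=; rewrite !linearZ; congr (_ *: _).
  by rewrite -gE -hE PS.
- split=> //.
    apply/cvg_ex; exists (\prod_(i < k) Num.max (opnorm (S i)) 1).
    apply: cvg_near_cst; exists k => // n /= kn.
    apply: (@prod_eventually1 _ (fun i => Num.max (opnorm (S i)) 1)) kn => i ki.
    by rewrite SA // A_norm maxxx.
  apply: (@series_eventually0 _ _ k) => i ki.
  by rewrite SA // A_xi subrr hnorm0.
- by exists k.
Qed.

(** On an elementary tensor of level at least k the approximations are all equal:
    the factors added later are xi i, and S i = A i fixes them. *)
Lemma E_set_acts_as X : E_set xi A X -> exists S k,
  [/\ acts_as S X, forall n, bounded_op (S n) & forall n, (k <= n)%N -> S n = A n].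
Proof.
move=> [S [[bS _ _] [k SA] [bX [P [hP hlim]]]]]; exists S, k; split=> //.
split=> //; exists k => n kn x.
apply: hcvg_unique (hlim n (tens (T n) (fun k : 'I_n.+1 => x k))) _.
apply: cvg_near_cst; exists n.+1 => // m /= nm.
rewrite (phi_embedding nm).2 (hP m).2 (etens_raise phi_embedding _ nm).
congr (lc_incl K (tens (T m) _)); apply: functional_extensionality_dep => i /=.
rewrite /pad; case: leqP => // ni.
by rewrite SA ?A_xi // (leq_trans kn (ltnW ni)).
Qed.

(** Infinite products of operators S i with sum |S i - A i| finite, as norm limits of
    the products F p with tail A from p on.  Consecutive F p differ in one
    factor only, so that |F (p+1) - F p| <= B |S p - A p| by the norm inequality. *)
Lemma infinite_tensor_exists S k0 (b d : nat -> R) (B : R) :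
  (forall i, linear (S i)) -> (forall i, opbound (S i) (b i)) ->
  (forall i, 1 <= b i) ->
  (forall n, (k0 <= n)%N -> \prod_(i < n.+1) b i <= B) ->
  (forall i, opbound (S i - A i) (d i)) -> (forall i, 0 <= d i) ->
  cvgn (series d) ->
  exists X F, [/\ bounded_op X, forall p, acts_as (with_tail S A p) (F p),
    forall v : K, (fun p => F p v) @ \oo --> X v &
    forall p, opbound (X - F p) (B * (limn (series d) - series d p))].
Proof.
move=> lS hS b1 hB hd d0 cd.
have b0 i : 0 <= b i by apply: le_trans (b1 i).
have B0 : 0 < B.
  apply: lt_le_trans (hB k0 (leqnn _)); apply: prodr_gt0 => i _.
  by apply: lt_le_trans (b1 i).
have lT p i : linear (with_tail S A p i).
  by rewrite /with_tail; case: ifP => // _; case: (A_bounded i).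
have hT p i : opbound (with_tail S A p i) (b i).
  rewrite /with_tail; case: ifP => // _; apply: opbound_le (b1 i).
  by rewrite -(A_norm i); apply: opbound_opnorm.
have /choice [F hF] p : exists X : K -> K, acts_as (with_tail S A p) X.
  apply: (@acts_as_exists _ _ _ _ _ phi_embedding _ _ b B (maxn k0 p)
    b0 (lT p) (hT p)).
    by move=> n; rewrite geq_max => /andP [k0n _]; apply: hB.
  by move=> i; rewrite geq_max => /andP [_ pi]; rewrite /with_tail ltnNge pi.
have step p : opbound (F p.+1 - F p) (B * d p).
  pose D : forall i, H i -> H i :=
    fun i => if i == p then S i - A i else with_tail S A p i.
  pose C i := if i == p then d i else b i.
  have rD : acts_as D (F p.+1 - F p).
    apply: (acts_as_diff_coord (p := p) (hF p.+1) (hF p)).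
    - by move=> i ip; rewrite /with_tail ltnS leq_eqVlt (negPf ip).
    - move=> i ip; rewrite /D (negPf ip) /with_tail ltnS.
      by rewrite [(i <= p)%N]leq_eqVlt (negPf ip).
    - by move=> u; rewrite /D eqxx /with_tail ltnn leqnn.
  apply: (acts_as_bound (k0 := maxn k0 p) (C := C) rD).
  - by move=> i; rewrite /C; case: ifP.
  - move=> i; rewrite /D; case: ifP => // _.
    exact: (bounded_opB (bounded_opE (lS i) (hS i)) (A_bounded i)).1.
  - by move=> i; rewrite /D /C; case: ifP.
  move=> n; rewrite geq_max => /andP [k0n pn].
  apply: le_trans (ler_wpM2r (d0 p) (hB n k0n)).
  (* Only the p-th factor differs: d p instead of b p >= 1. *)
  pose q : 'I_n.+1 := Ordinal (pn : (p < n.+1)%N).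
  rewrite (bigD1 q) //= [in leRHS](bigD1 q) //= {1}/C eqxx.
  rewrite (eq_bigr (fun i : 'I_n.+1 => b i)) => [|i iq]; last first.
    by rewrite /C ifN //; apply: contra iq => /eqP ip; apply/eqP/val_inj.
  set r := \prod_(i < _ | _) _; have r0 : 0 <= r by apply: prodr_ge0.
  by rewrite -mulrA [r * d p]mulrC -[leLHS]mul1r ler_wpM2r ?mulr_ge0.
have [dl dt] := series_tail d0 cd.
have tele p q : (p <= q)%N -> opbound (F q - F p) (B * (series d q - series d p)).
  elim: q => [|q IH].
    by rewrite leqn0 => /eqP ->; rewrite !subrr mulr0 => v; rewrite mul0r hnorm0.
  rewrite leq_eqVlt => /predU1P [<-|pq].
    by rewrite !subrr mulr0 => v; rewrite mul0r hnorm0.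
  have := opbound_dist (step q) (IH pq); rewrite -mulrDr /series /=.
  by rewrite [in X in opbound _ (B * (X - _))]big_nat_recr //= addrA [d q + _]addrC.
have [] := @op_complete _ _ _ F (fun p => B * (limn (series d) - series d p)).
- by move=> p; case: (hF p).
- move=> e e0; have [|N hN] := dt (e / B); first by rewrite divr_gt0.
  by exists N; rewrite mulrC -ltr_pdivlMr // hN.
- move=> p q pq; apply: opbound_le (tele p q pq) _.
  by rewrite ler_pM2l // lerB.
by move=> X [bX cX oX]; exists X, F; split.
Qed.

End InfLimit.

(** * Norm closures and generated C*-algebras *)

Section CstarAlgebras.
Context {R : realType} {V : hilbertType R}.
Implicit Types (B : set (V -> V)) (f g : V -> V).

Lemma adjoint_opC f g : adjoint_op f g -> adjoint_op g f.
Proof. by move=> h x y; rewrite innerC -h -innerC. Qed.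

Lemma adjoint_op_uniq f g g' : adjoint_op f g -> adjoint_op f g' -> g = g'.
Proof.
by move=> h h'; apply/funext => y; apply: inner_injr => x; rewrite -h h'.
Qed.

Lemma adjoint_opB f g f' g' : adjoint_op f f' -> adjoint_op g g' ->
  adjoint_op (f - g) (f' - g').
Proof. by move=> hf hg x y; rewrite linearBl linearBr /= hf hg. Qed.

Lemma opnorm_closureP B : (forall f, B f -> bounded_op f) -> forall f,
  opnorm_closure B f <->
  bounded_op f /\ forall e : R, 0 < e -> exists2 g, B g & opbound (f - g) e.
Proof.
move=> bB f; split=> -[bf h]; split=> // e e0.
  have [g Bg hg] := h e e0; exists g => //; apply: opbound_le (ltW hg).
  by apply: opbound_opnorm; apply: bounded_opB => //; apply: bB.
have [|g Bg hg] := h (e / 2); first by rewrite divr_gt0.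
exists g => //; apply: (@le_lt_trans _ _ (e / 2)).
  by apply: opnorm_le => //; rewrite divr_ge0 // ltW.
by rewrite ltr_pdivrMr // ltr_pMr // ltr1n.
Qed.

Lemma sub_opnorm_closure B : (forall f, B f -> bounded_op f) ->
  B `<=` opnorm_closure B.
Proof.
move=> bB f Bf; apply/opnorm_closureP => //; split=> [|e e0]; first exact: bB.
by exists f => // x; rewrite subrr hnorm0 mulr_ge0 ?hnorm_ge0 // ltW.
Qed.

Lemma opnorm_closureS B B' : B `<=` B' -> opnorm_closure B `<=` opnorm_closure B'.
Proof.
move=> BB' f [bf h]; split=> // e e0.
by have [g Bg hg] := h e e0; exists g => //; apply: BB'.
Qed.

Lemma opnorm_closure_idem B : (forall f, B f -> bounded_op f) ->
  opnorm_closure (opnorm_closure B) `<=` opnorm_closure B.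
Proof.
move=> bB f /opnorm_closureP [|bf h]; first by move=> g [].
apply/opnorm_closureP => //; split=> // e e0.
have [|g /opnorm_closureP [//|bg hg] fg] := h (e / 2); first by rewrite divr_gt0.
have [|g' Bg' gg'] := hg (e / 2); first by rewrite divr_gt0.
by exists g' => //; have := opbound_dist fg gg'; rewrite -splitr.
Qed.

Lemma opnorm_closure_subalgebra B :
  is_subalgebra B -> is_subalgebra (opnorm_closure B).
Proof.
move=> [bB B0 BD BZ BM]; have cP := opnorm_closureP bB; split.
- by move=> f [].
- exact: sub_opnorm_closure.
- move=> f g /cP [bf hf] /cP [bg hg]; apply/cP; split; first exact: bounded_opD.
  move=> e e0; have e20 : 0 < e / 2 by rewrite divr_gt0.
  have [f' Bf' ff'] := hf _ e20; have [g' Bg' gg'] := hg _ e20.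
  exists (f' + g'); first exact: BD.
  by have := opboundD ff' gg'; rewrite -splitr opprD addrACA.
- move=> a f /cP [bf hf]; apply/cP; split; first exact: bounded_opZ.
  move=> e e0; set c := Normc.normc a.
  have c0 : 0 <= c by rewrite -ler0c (_ : c%:C = `|a|).
  have [|f' Bf' ff'] := hf (e / (c + 1)); first by rewrite divr_gt0 // ltr_wpDl.
  exists (a *: f'); first exact: BZ.
  have := opboundZ a ff'; rewrite scalerBr => /opbound_le; apply.
  rewrite -/c mulrA ler_pdivrMr ?ltr_wpDl // mulrC ler_wpM2l ?ltW //.
  by rewrite ltrDl.
move=> f g /cP [bf hf] /cP [bg hg]; apply/cP; split; first exact: bounded_op_comp.
move=> e e0; have [c [c0 hc]] := opbound_ge0 bf; have [d [d0 hd]] := opbound_ge0 bg.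
have [|g' Bg' gg'] := hg (Num.min 1 (e / 2 / (c + 1))).
  by rewrite lt_min ltr01 !divr_gt0 // ltr_wpDl.
have [|f' Bf' ff'] := hf (e / 2 / (d + 1)); first by rewrite !divr_gt0 // ltr_wpDl.
exists (f' \o g'); first exact: BM.
have hg' : opbound g' (d + 1).
  have := opboundD (opboundBC gg') hd; rewrite subrK => /opbound_le; apply.
  by rewrite addrC lerD // ge_min lexx.
have h1 : opbound (f \o (g - g')) (c * (e / 2 / (c + 1))).
  apply: opbound_comp => //; apply: opbound_le gg' _.
  by rewrite ge_min lexx orbT.
have h2 : opbound ((f - f') \o g') (e / 2 / (d + 1) * (d + 1)).
  by apply: opbound_comp => //; rewrite !divr_ge0 ?ltW // ltr_wpDl.
have := opboundD h1 h2.
have -> : (f \o (g - g')) + ((f - f') \o g') = (f \o g) - (f' \o g').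
  apply/funext => x; have [h hE] := linear_pack bf.1.
  by rewrite !fctE hE /= linearB addrA subrK.
move/opbound_le; apply; rewrite divfK ?gt_eqF ?ltr_wpDl //.
rewrite [leRHS]splitr lerD2r mulrCA -[leRHS]mulr1 ler_wpM2l ?divr_ge0 ?ltW //.
by rewrite ltr_pdivrMr ?ltr_wpDl // mul1r ltrDl.
Qed.

Lemma cstar_bounded : is_cstar_subalgebra [set f : V -> V | bounded_op f].
Proof.
split; last by [].
- split=> //=; [exact: bounded_op0|exact: bounded_opD|exact: bounded_opZ
    |exact: bounded_op_comp].
- by move=> f [].
Qed.

Lemma generated_cstarP B : (forall f, B f -> bounded_op f) ->
  is_cstar_subalgebra (generated_cstar B).
Proof.
move=> bB.
have sub D : is_cstar_subalgebra D -> B `<=` D -> generated_cstar B `<=` D.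
  by move=> cD BD f; apply.
have subb := sub _ cstar_bounded bB.
split.
- split=> //.
  + by move=> D [[[]]].
  + move=> f g hf hg D hD; have [[[_ _ h _ _] _ _] _] := hD.
    by apply: h; [apply: hf|apply: hg].
  + move=> a f hf D hD; have [[[_ _ _ h _] _ _] _] := hD.
    by apply: h; apply: hf.
  + move=> f g hf hg D hD; have [[[_ _ _ _ h] _ _] _] := hD.
    by apply: h; [apply: hf|apply: hg].
- move=> f hf D hD; have [[_ h _] BD] := hD; apply: h.
  by move: hf; apply: opnorm_closureS; apply: sub => //; case: hD.
- move=> f g hf bg fg D hD; have [[_ _ h] _] := hD.
  by apply: (h f) => //; apply: hf.
Qed.

(** Only closedness is not formal: if f_p tends to f, the adjoints g_p form a Cauchy
    sequence since taking adjoints does not increase norm bounds, and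
    their limit is adjoint to f. *)
Lemma cstar_selfadjoint_part B : is_subalgebra B -> opnorm_closure B `<=` B ->
  is_cstar_subalgebra [set f | B f /\ exists2 g, B g & adjoint_op f g].
Proof.
move=> [bB B0 BD BZ BM] cB; split.
- split.
  + by move=> f [/bB].
  + by split=> //; exists 0 => // x y; rewrite linear0l linear0r.
  + move=> f g [Bf [f' Bf' ff']] [Bg [g' Bg' gg']]; split; first exact: BD.
    exists (f' + g'); first exact: BD.
    by move=> x y; rewrite linearDl linearDr /= ff' gg'.
  + move=> a f [Bf [f' Bf' ff']]; split; first exact: BZ.
    exists (a^*%R *: f'); first exact: BZ.
    by move=> x y; rewrite innerZl innerZr conjCK ff'.
  + move=> f g [Bf [f' Bf' ff']] [Bg [g' Bg' gg']]; split; first exact: BM.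
    exists (g' \o f'); first exact: BM.
    by move=> x y /=; rewrite ff' gg'.
- move=> f hf; have Bf : B f.
    by apply: cB; apply: opnorm_closureS hf => g [].
  split=> //; move/opnorm_closureP: hf => [|bf hf]; first by move=> g [/bB].
  have /choice [F hF] p : exists fg : (V -> V) * (V -> V),
      [/\ B fg.1, B fg.2, adjoint_op fg.1 fg.2 & opbound (f - fg.1) p.+1%:R^-1].
    have [|g [Bg [g' Bg' gg']] hg] := hf p.+1%:R^-1; first by rewrite invr_gt0.
    by exists (g, g').
  have inv0 p : 0 <= p.+1%:R^-1 :> R by rewrite invr_ge0.
  have [||| g [bg _ gF]] := @op_complete _ _ _
    (fun p => (F p).2) (fun p => 2 * p.+1%:R^-1).
  + by move=> p; apply: bB; case: (hF p).
  + move=> e e0; have [|N hN] := @near_natSinv R (e / 2); first by rewrite divr_gt0.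
    by exists N; rewrite mulrC -ltr_pdivlMr // hN.
  + move=> p q pq; have [_ _ ap hp] := hF p; have [_ _ aq hq] := hF q.
    apply: (adjoint_opbound _ (adjoint_opB aq ap)); first by rewrite mulr_ge0.
    have := opbound_dist (opboundBC hq) hp => /opbound_le; apply.
    by rewrite mulr_natl mulr2n lerD2r lef_pV2 ?posrE // ler_nat ltnS.
  exists g.
    apply: cB; apply/opnorm_closureP => //; split=> // e e0.
    have [|N hN] := @near_natSinv R (e / 2); first by rewrite divr_gt0.
    exists (F N).2; first by case: (hF N).
    apply: opbound_le (gF N) _; rewrite mulrC -ler_pdivlMr // ltW // hN //.
  move=> x y; apply/eqP; rewrite -subr_eq0; apply/eqP.
  apply: (@small_eq0 _ _ (3 * (hnorm x * hnorm y))) => [|e e0].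
    by rewrite !mulr_ge0 ?hnorm_ge0.
  have [N /(_ N (leqnn N)) /ltW hN] := near_natSinv e0.
  have [_ _ a h1] := hF N; have h2 := gF N.
  have -> : inner (f x) y - inner x (g y) =
      inner ((f - (F N).1) x) y - inner x ((g - (F N).2) y).
    by rewrite linearBl linearBr /= a; ring.
  apply: le_trans (ler_normB _ _) _.
  apply: (@le_trans _ _ (N.+1%:R^-1 * (3 * (hnorm x * hnorm y)))%:C); last first.
    by rewrite lecR ler_wpM2r // !mulr_ge0 ?hnorm_ge0.
  have -> : N.+1%:R^-1 * (3 * (hnorm x * hnorm y)) =
    N.+1%:R^-1 * hnorm x * hnorm y + hnorm x * (2 * N.+1%:R^-1 * hnorm y) by ring.
  rewrite rmorphD /= lerD //.
    apply: le_trans (cauchy_schwarz _ _) _.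
    by rewrite lecR ler_wpM2r ?hnorm_ge0 // h1.
  apply: le_trans (cauchy_schwarz _ _) _.
  by rewrite lecR ler_wpM2l ?hnorm_ge0 // h2.
- move=> f g [Bf [f' Bf' ff']] bg fg.
  rewrite (adjoint_op_uniq fg ff'); split=> //; exists f => //.
  exact: adjoint_opC.
Qed.

End CstarAlgebras.

(** * Commuting multiples of a nilpotent operator *)

Section Nilpotent.
Context {R : realType} {V : hilbertType R}.

(** For a fixed L these operators form an algebra, consisting of nilpotents
    when L is nilpotent. *)
Definition commuting_multiple (L X : V -> V) : Prop :=
  (forall v, X (L v) = L (X v)) /\ exists Y, forall v, X v = L (Y v).

(** X (L^p w) = L^p (X w) = L^(p+1) (Y w). *)
Lemma commuting_multiple_iter L X : commuting_multiple L X ->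
  forall p v, exists w, iter p X v = iter p L w.
Proof.
move=> [XL [Y XY]] p v; exists (iter p Y v).
have comm q w : X (iter q L w) = iter q L (X w).
  by elim: q => //= q IH; rewrite XL IH.
elim: p => //= p IH.
by rewrite IH comm XY -iterSr.
Qed.

Lemma commuting_multiple_nilpotent L X :
  nilpotent_op L -> commuting_multiple L X -> nilpotent_op X.
Proof.
move=> [d Ld] h; exists d => v.
by have [w ->] := commuting_multiple_iter h d v.
Qed.

Lemma commuting_multiple_lim L X (Y : V -> V) (F G : nat -> V -> V) : bounded_op L ->
  (forall v, (fun p => F p v) @ \oo --> X v) ->
  (forall v, (fun p => G p v) @ \oo --> Y v) ->
  (exists N, forall p, (N <= p)%N -> F p \o L = L \o F p /\ F p = L \o G p) ->
  commuting_multiple L X.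
Proof.
move=> bL FX GY [N hN]; split=> [v|].
  apply: hcvg_unique (FX (L v)) _; apply: hcvg_eq (bounded_op_cvg bL (FX v)).
  exists N => p Np; by have [/(congr1 (fun f => f v)) /= -> _] := hN p Np.
exists Y => v; apply: hcvg_unique (FX v) _.
apply: hcvg_eq (bounded_op_cvg bL (GY v)); exists N => p Np.
by have [_ /(congr1 (fun f => f v)) /= ->] := hN p Np.
Qed.

Lemma commuting_multiple0 L : linear L -> commuting_multiple L 0.
Proof.
move=> /linear_pack [g ->]; split=> [v|]; first by rewrite linear0.
by exists (fun=> 0) => v; rewrite linear0.
Qed.

Lemma commuting_multipleD L X X' : linear L -> commuting_multiple L X ->
  commuting_multiple L X' -> commuting_multiple L (X + X').
Proof.
move=> /linear_pack [g ->] [c [Y h]] [c' [Y' h']]; split=> [v|].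
  by rewrite !fctE c c' linearD.
by exists (Y + Y') => v; rewrite !fctE h h' linearD.
Qed.

Lemma commuting_multipleZ L a X : linear L -> commuting_multiple L X ->
  commuting_multiple L (a *: X).
Proof.
move=> /linear_pack [g ->] [c [Y h]]; split=> [v|].
  by rewrite !fctE c linearZ.
by exists (a *: Y) => v; rewrite !fctE h linearZ.
Qed.

Lemma commuting_multiple_comp L X X' : commuting_multiple L X ->
  commuting_multiple L X' -> commuting_multiple L (X \o X').
Proof.
move=> [c [Y h]] [c' _]; split=> [v|]; first by rewrite /= c' c.
by exists (Y \o X') => v; rewrite /= h.
Qed.

End Nilpotent.

(** * The algebra of nilpotents *)

Section Main.
Context {R : realType} {H : nat -> finHilbertType R}.
Variables A M : forall n, H n -> H n.
Arguments A : clear implicits.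
Arguments M : clear implicits.
Context {xi : forall n, H n}.
Hypothesis A_pos : forall n, positive_op (A n).
Hypothesis A_norm : forall n, opnorm (A n) = 1.
Hypothesis M_bounded : forall n, bounded_op (M n).
Hypothesis M_nil : forall n, nilpotent_op (M n).
Hypothesis AM_summable : cvgn (series (fun n => opnorm (A n - M n))).
Hypothesis xi_unit : forall n, hnorm (xi n) = 1.
Hypothesis A_xi : forall n, A n (xi n) = xi n.
Context {T : forall n, tensor_product (fun k : 'I_n.+1 => H k)}.
Context {phi : forall n m, T n -> T m}.
Hypothesis phi_embedding : forall n m, (n < m)%N ->
  is_tensor_embedding xi (@phi n m).
Variable K : limit_completion phi.

Let A_bounded n : bounded_op (A n). Proof. by case: (A_pos n). Qed.

Let A1 n : opbound (A n) 1.
Proof. by rewrite -(A_norm n); apply: opbound_opnorm. Qed.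

Definition at_coord n (f : H n -> H n) : forall i, H i -> H i :=
  dfwith (fun i => idfun : H i -> H i) n f.

Lemma at_coord_exists n (f : H n -> H n) : bounded_op f ->
  exists L : K -> K, acts_as (at_coord f) L.
Proof.
move=> bf; have [c [c0 hc]] := opbound_ge0 bf.
pose C i := if i == n then c else 1.
apply: (@acts_as_exists _ _ _ _ _ phi_embedding _ _ C c n.+1).
- by move=> i; rewrite /C; case: ifP.
- move=> i; rewrite /at_coord; case: dfwithP => [|j jn]; first exact: bf.1.
  by move=> a u v.
- move=> i; rewrite /at_coord /C; case: dfwithP => [|j jn]; first by rewrite eqxx.
  by rewrite eq_sym (negPf jn) => x; rewrite mul1r.
- move=> l nl; rewrite (@prod_eventually1 _ C n.+1) ?(leqW nl) //.
    rewrite big_ord_recr /= {2}/C eqxx big1 ?mul1r // => i _.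
    by rewrite /C ltn_eqF.
  by move=> i ni; rewrite /C gtn_eqF.
- by move=> i ni; rewrite /at_coord dfwithout // ltn_eqF.
Qed.

Lemma at_coord_nilpotent n (f : H n -> H n) (L : K -> K) :
  bounded_op f -> nilpotent_op f -> acts_as (at_coord f) L -> nilpotent_op L.
Proof.
move=> bf [d fd] hL; exists d => v.
(* The n-th factor of the d-th power is 0, hence so is the norm bound. *)
pose C i : R := if i == n then 0 else 1.
suff h : opbound (iter d L) 0.
  by apply/hnorm_eq0/le_anti; rewrite hnorm_ge0 andbT; have := h v; rewrite mul0r.
apply: (acts_as_bound (k0 := n) (C := C) (acts_as_iter d hL)).
- by move=> i; rewrite /C; case: ifP.
- move=> i; rewrite /at_coord; case: dfwithP => [|j jn].
    by move=> a u w; rewrite !fd scaler0 addr0.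
  by move=> a u w; rewrite !iter_fix.
- move=> i; rewrite /at_coord /C; case: dfwithP => [|j jn].
    by move=> x; rewrite eqxx fd mul0r hnorm0.
  by rewrite eq_sym (negPf jn) => x; rewrite mul1r iter_fix.
- move=> l nl; pose q : 'I_l.+1 := Ordinal (nl : (n < l.+1)%N).
  by rewrite (bigD1 q) //= /C eqxx mul0r.
Qed.

Lemma coordL_exists : exists L : nat -> K -> K,
  forall n, acts_as (at_coord (M n)) (L n).
Proof.
have /choice [L hL] n : exists L : K -> K, acts_as (at_coord (M n)) L.
  exact: at_coord_exists.
by exists L.
Qed.

Variable L : nat -> K -> K.
Hypothesis L_acts_as : forall n, acts_as (at_coord (M n)) (L n).

(** The dense algebra of nilpotents; L n acts as M n on coordinate n and
    trivially elsewhere. *)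
Definition nil_alg : set (K -> K) :=
  [set X | C_alg xi K A X /\
     exists k, forall n, (k <= n)%N -> commuting_multiple (L n) X].

Let C_cstar : is_cstar_subalgebra (C_alg xi K A).
Proof. by apply: generated_cstarP => X [S [_ _ []]]. Qed.

Lemma nil_alg_subalgebra : is_subalgebra nil_alg.
Proof.
have [[Cb C0 CD CZ CM] _ _] := C_cstar.
have lL n : linear (L n) by have [[]] := L_acts_as n.
split.
- by move=> f [/Cb].
- by split=> //; exists 0%N => n _; apply: commuting_multiple0.
- move=> f g [Cf [k hf]] [Cg [l hg]]; split; first exact: CD.
  exists (maxn k l) => n; rewrite geq_max => /andP [kn ln].
  by apply: commuting_multipleD; [|apply: hf|apply: hg].
- move=> a f [Cf [k hf]]; split; first exact: CZ.
  by exists k => n kn; apply: commuting_multipleZ; [|apply: hf].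
- move=> f g [Cf [k hf]] [Cg [l hg]]; split; first exact: CM.
  exists (maxn k l) => n; rewrite geq_max => /andP [kn ln].
  by apply: commuting_multiple_comp; [apply: hf|apply: hg].
Qed.

Lemma nil_alg_nilpotent X : nil_alg X -> nilpotent_op X.
Proof.
move=> [_ [k hk]]; apply: commuting_multiple_nilpotent (hk k (leqnn k)).
exact: at_coord_nilpotent (L_acts_as k).
Qed.

Let delta i := opnorm (A i - M i).

Let delta_bound i : opbound (A i - M i) (delta i).
Proof. by apply: opbound_opnorm; apply: bounded_opB. Qed.

Let opbound_pos i (f : H i -> H i) (c : R) : opbound f c -> 0 <= c.
Proof.
move=> /(_ (@xi i)); rewrite xi_unit mulr1.
by apply: le_trans; apply: hnorm_ge0.
Qed.

Let delta_ge0 i : 0 <= delta i.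
Proof. exact: opbound_pos (@delta_bound i). Qed.

Let M_delta i : opbound (M i) (1 + delta i).
Proof.
have := opboundD (opboundBC (@delta_bound i)) (@A1 i).
by rewrite subrK addrC.
Qed.

(** X has the factors S i below m and M i from m on; that it is a multiple of L n is
    seen by deleting the factor M n.  The rate of convergence r is uniform in m:
    at p = m, where the approximating operator has the factors S i throughout, it
    bounds the distance from X to the product of the S i. *)
Lemma nil_tail_limit S k : (forall i, bounded_op (S i)) ->
  (forall i, (k <= i)%N -> S i = A i) ->
  exists r : nat -> R,
  (forall e, 0 < e -> exists N, forall m, (N <= m)%N -> r m < e) /\
  forall m, (k <= m)%N -> exists X F, [/\ bounded_op X,
    forall p : nat, acts_as (with_tail (with_tail S M m) A p) (F p),
    forall p, opbound ((X : K -> K) - F p) (r p) &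
    forall n, (m <= n)%N -> commuting_multiple (L n) X].
Proof.
move=> bS SA.
(* The bounds c of S and s of S - A are trivial from k on, where S is A. *)
pose c i := if (i < k)%N then Num.max (opnorm (S i)) 1 else 1.
have c1 i : 1 <= c i by rewrite /c; case: ifP => // _; rewrite le_max lexx orbT.
have Sc i : opbound (S i) (c i).
  rewrite /c; case: ltnP => [ik|ki]; last by rewrite SA.
  by apply: opbound_le (opbound_opnorm (bS i)) _; rewrite le_max lexx.
pose s i := if (i < k)%N then opnorm (S i - A i) else 0.
have Ss i : opbound (S i - A i) (s i).
  rewrite /s; case: ltnP => [ik|ki].
    by apply: opbound_opnorm; apply: bounded_opB.
  by rewrite SA // subrr => x; rewrite hnorm0 mul0r.
have s0 i : 0 <= s i by apply: opbound_pos (Ss i).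
(* b bounds S i and M i, and also the identity that replaces a deleted
   factor, since b i >= 1. *)
pose b i := c i * (1 + delta i).
have d1 i : 1 <= 1 + delta i by rewrite lerDl.
have cb i : c i <= b i by rewrite /b ler_peMr // (le_trans _ (c1 i)).
have b1 i : 1 <= b i by apply: le_trans (cb i).
have db i : 1 + delta i <= b i by rewrite /b ler_peMl // (le_trans _ (d1 i)).
pose d := s \+ delta.
have d0 i : 0 <= d i by rewrite addr_ge0.
have cd : cvgn (series d).
  apply: is_cvg_seriesD AM_summable; apply: (series_eventually0 (k := k)) => i ki.
  by rewrite /s ltnNge ki.
have [dl _] := series_tail delta_ge0 AM_summable.
set ld := limn _ in dl.
pose B := (\prod_(i < k) c i) * expR ld.
have B0 : 0 < B.
  rewrite mulr_gt0 ?expR_gt0 //; apply: prodr_gt0 => i _.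
  exact: lt_le_trans (c1 i).
have hB n : (k <= n)%N -> \prod_(i < n.+1) b i <= B.
  move=> kn; rewrite big_split /= (@prod_eventually1 _ c k) ?leqW //; last first.
    by move=> i ki; rewrite /c ltnNge ki.
  rewrite ler_wpM2l ?prod_1D_le_expR // prodr_ge0 // => i _.
  exact: le_trans (c1 i).
exists (fun m => B * (limn (series d) - series d m)); split.
  move=> e e0; have [_ h] := series_tail d0 cd.
  have [|N hN] := h (e / B); first by rewrite divr_gt0.
  by exists N => m Nm; rewrite mulrC -ltr_pdivlMr // hN.
move=> m km; pose S' := with_tail S M m.
have lS' i : linear (S' i).
  by rewrite /S' /with_tail; case: ifP => _; [case: (bS i)|case: (M_bounded i)].
have bS' i : opbound (S' i) (b i).
  rewrite /S' /with_tail; case: ifP => _; first exact: opbound_le (Sc i) _.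
  exact: opbound_le (@M_delta i) _.
have dS' i : opbound (S' i - A i) (d i).
  rewrite /S' /with_tail; case: ifP => _.
    by apply: opbound_le (Ss i) _; rewrite lerDl.
  by apply: opbound_le (opboundBC (@delta_bound i)) _; rewrite lerDr.
have [X [F [bX hF FX oX]]] :=
  infinite_tensor_exists (K := K) phi_embedding A_bounded A_norm A_xi
  lS' bS' b1 hB dS' d0 cd.
exists X, F; split=> // n mn.
(* S'' is S' with the factor M n deleted; this costs at most
   |1 - A n| <= 2 in the sum. *)
pose S'' : forall i, H i -> H i := dfwith S' n idfun.
pose d'' i := d i + (if i == n then 2 else 0).
have b0 i : 0 <= b i := le_trans ler01 (b1 i).
have lS'' i : linear (S'' i).
  by rewrite /S''; case: dfwithP => [|j _] // a u v.
have bS'' i : opbound (S'' i) (b i).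
  rewrite /S''; case: dfwithP => [|j _] // v.
  by rewrite -[leLHS]mul1r ler_wpM2r ?hnorm_ge0.
have dS'' i : opbound (S'' i - A i) (d'' i).
  rewrite /S'' /d''; case: dfwithP => [|j jn].
    rewrite eqxx.
    have h1 : opbound (idfun : H n -> H n) 1 by move=> v; rewrite mul1r.
    have h2 : opbound (- A n) 1 by move=> v; rewrite hnormN; apply: A1.
    by apply: opbound_le (opboundD h1 h2) _; rewrite lerDr.
  by rewrite eq_sym (negPf jn) addr0.
have d''0 i : 0 <= d'' i by rewrite addr_ge0 //; case: ifP.
have cd'' : cvgn (series d'').
  apply: is_cvg_seriesD cd _; apply: (series_eventually0 (k := n.+1)) => i ni.
  by rewrite gtn_eqF.
have [Y [G [bY hG GY _]]] :=
  infinite_tensor_exists (K := K) phi_embedding A_bounded A_norm A_xi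
  lS'' bS'' b1 hB dS'' d''0 cd''.
have lL : bounded_op (L n) by case: (L_acts_as n).
apply: (commuting_multiple_lim lL FX GY); exists n.+1 => p np.
have Sn : with_tail S' A p n = M n by rewrite /with_tail np /S' /with_tail ltnNge mn.
split.
  apply: acts_as_uniq (acts_as_comp (hF p) (L_acts_as n)) _.
  have := acts_as_comp (L_acts_as n) (hF p); congr (acts_as _ _).
  apply: functional_extensionality_dep => i; rewrite /at_coord.
  by case: dfwithP => [|j _] //; rewrite -/S' Sn.
apply: acts_as_uniq (hF p) _.
have := acts_as_comp (L_acts_as n) (hG p); congr (acts_as _ _).
apply: functional_extensionality_dep => i; rewrite /at_coord.
have [->|ni] := eqVneq i n.
  by rewrite dfwithin -/S' Sn /with_tail np /S'' dfwithin.
by rewrite dfwithout 1?eq_sym // /with_tail /S'' dfwithout 1?eq_sym.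
Qed.

Lemma nil_tail_in_nil_alg S m X F (r : nat -> R) :
  (forall i, bounded_op (S i)) -> bounded_op X ->
  (forall e, 0 < e -> exists N, forall m, (N <= m)%N -> r m < e) ->
  (forall p : nat, acts_as (with_tail (with_tail S M m) A p) (F p)) ->
  (forall p, opbound ((X : K -> K) - F p) (r p)) ->
  (forall n, (m <= n)%N -> commuting_multiple (L n) X) -> nil_alg X.
Proof.
move=> bS bX r0 hF oX hX; split; last by exists m.
have [[Cb _ _ _ _] Ccl _] := C_cstar.
apply: Ccl; apply/opnorm_closureP => //; split=> // e e0.
have [N hN] := r0 e e0; exists (F N); last first.
  exact: opbound_le (oX N) (ltW (hN N (leqnn N))).
move=> D [_ ED]; apply: ED.
apply: (acts_as_E_set (k := N) A_norm A_xi (hF N)).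
  move=> n; rewrite /with_tail; case: ifP => _; last exact: A_bounded.
  by rewrite /with_tail; case: ifP.
by move=> n Nn; rewrite /with_tail ltnNge Nn.
Qed.

(** Switching to the tail M at a late coordinate m changes X by at most r m. *)
Lemma E_set_sub_closure : E_set (K := K) xi A `<=` opnorm_closure nil_alg.
Proof.
move=> X /(E_set_acts_as phi_embedding A_xi) [S [k [hX bS SA]]].
have [Nb _ _ _ _] := nil_alg_subalgebra.
apply/opnorm_closureP => //; split=> [|e e0]; first by case: hX.
have [r [r0 hr]] := nil_tail_limit bS SA.
have [N hN] := r0 e e0; have [Y [F [bY hF oY fY]]] := hr _ (leq_maxr N k).
exists Y; first exact: nil_tail_in_nil_alg bS bY r0 hF oY fY.
have <- : F (maxn N k) = X.
  apply: acts_as_uniq (hF _) _; move: hX; congr (acts_as _ _).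
  apply: functional_extensionality_dep => i; rewrite /with_tail.
  case: ltnP => // /(leq_trans (leq_maxr N k)) ki; exact: SA.
apply: opboundBC; apply: opbound_le (oY _) (ltW (hN _ _)).
exact: leq_maxl.
Qed.

(** The adjoint acts as the product of the adjoints of the factors, which is
    again in the generating set since the tail A consists of self-adjoint
    operators fixing the xi. *)
Lemma E_set_adjoint (X : K -> K) : E_set xi A X ->
  exists2 X' : K -> K, E_set xi A X' & adjoint_op X X'.
Proof.
move=> /(E_set_acts_as phi_embedding A_xi) [S [k [hX bS SA]]].
have h i : exists f : H i -> H i,
    [/\ bounded_op f, adjoint_op (S i) f & (k <= i)%N -> f = A i].
  have [ki|ik] := leqP k i.
    exists (A i); split=> //; rewrite SA //; exact: positive_selfadjoint.
  by have [f [bf af]] := adjoint_fin (bS i); exists f; split=> //; rewrite leqNgt ik.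
pose S' i := projT1 (cid (h i)).
have S'P i : [/\ bounded_op (S' i), adjoint_op (S i) (S' i) &
    (k <= i)%N -> S' i = A i].
  by rewrite /S'; case: cid.
have bS' i : bounded_op (S' i) by case: (S'P i).
have S'A i : (k <= i)%N -> S' i = A i by case: (S'P i).
have /choice [c hc] i := opbound_ge0 (bS' i).
pose C i := if (i < k)%N then c i else 1.
have [||||| X' hX'] := @acts_as_exists _ _ _ _ _ phi_embedding K
  S' C (\prod_(i < k) C i) k.
- by move=> i; rewrite /C; case: ifP => // _; case: (hc i).
- by move=> i; case: (bS' i).
- move=> i; rewrite /C; case: ltnP => [_|ki]; first by case: (hc i).
  by rewrite S'A //; apply: A1.
- move=> n kn; rewrite (@prod_eventually1 _ C k) ?leqW // => i ki.
  by rewrite /C ltnNge ki.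
- by move=> i ki; rewrite S'A.
exists X'; first by apply: (acts_as_E_set (k := k) A_norm A_xi hX').
apply: (acts_as_adjoint phi_embedding hX hX') => i; by case: (S'P i).
Qed.

(** Minimality of the generated C*-algebra, tested against the self-adjoint part
    of the closure of [nil_alg]. *)
Lemma C_alg_sub_closure : C_alg xi K A `<=` opnorm_closure nil_alg.
Proof.
have hN := nil_alg_subalgebra; have [Nb _ _ _ _] := hN.
have cD := cstar_selfadjoint_part (opnorm_closure_subalgebra hN)
  (opnorm_closure_idem Nb).
move=> X /(_ _ (conj cD _)) [] // Y EY; split; first exact: E_set_sub_closure.
have [Y' EY' YY'] := E_set_adjoint EY.
by exists Y' => //; apply: E_set_sub_closure.
Qed.

End Main.

Unset Implicit Arguments.

Theorem theorem4p6 (R : realType) (H : nat -> finHilbertType R)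
    (A M : forall n, H n -> H n) (xi : forall n, H n)
    (A_pos : forall n, positive_op (A n))
    (A_norm : forall n, opnorm (A n) = 1)
    (M_bounded : forall n, bounded_op (M n))
    (M_nil : forall n, nilpotent_op (M n))
    (AM_summable : cvgn (series (fun n => opnorm (A n - M n))))
    (xi_unit : forall n, hnorm (xi n) = 1)
    (A_xi : forall n, A n (xi n) = xi n)
    (T : forall n, tensor_product (fun k : 'I_n.+1 => H k))
    (phi : forall n m, T n -> T m)
    (phi_embedding : forall n m, (n < m)%N ->
       is_tensor_embedding xi (phi n m))
    (K : limit_completion phi) :
  exists N : set (K -> K),
    [/\ is_subalgebra N,
        N `<=` C_alg xi K A,
        C_alg xi K A `<=` opnorm_closure N &
        forall X, N X -> nilpotent_op X].
Proof.
have [L hL] := coordL_exists M_bounded phi_embedding K.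
exists (nil_alg A (xi := xi) L); split.
- exact: nil_alg_subalgebra hL.
- by move=> X [].
- exact: C_alg_sub_closure hL.
- exact: nil_alg_nilpotent hL.
Qed.
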